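(* Let $m\ge1$ and suppose $u_1,\ldots,u_m,v_1,\ldots,v_m$ satisfy $v_i>u_i>0$ for each $i$. Let $\delta=\sum_{i=1}^m(v_i-u_i)$, $p(c)=\prod_{i=1}^m(c+1-u_i)$, $q(c)=\prod_{i=1}^m(c+2-v_i)$, $q_1(c)=(1+c)q(c)-cq(c-1)$, $\nabla g(c)=g(c)-g(c-1)$, and for $0\le k\le m-1$ $$R_k'(\gamma)=\frac{1}{k!}\nabla^kp(\gamma)-\frac{1}{(k+1)!}\nabla^kq_1(\gamma).$$ Define $c_0=1$, $c_i=0$ for $i<0$, and for $n\ge1$ $$c_n=\frac1n\sum_{k=1}^{\min(m-1,n)}\frac{1}{(-n-\delta+1)_k}R'_{m-1-k}(n-k+\delta-1)\,c_{n-k}+\frac{1}{n(-n-\delta+1)_{m-1}}q(n-m+\delta-1)\,c_{n-m}.$$ Then there is a density function $f$ on $[0,1]$ with moment sequence $\int_0^1x^nf(x)\,dx=\prod_{i=1}^m\frac{(u_i)_n}{(v_i)_n}$, $n=0,1,2,\ldots$, and for $0<x\le1$ $$f(x)=\frac{1}{\Gamma(\delta)}\prod_{i=1}^m\frac{\Gamma(v_i)}{\Gamma(u_i)}(1-x)^{\delta-1}\left\{1+\sum_{n=1}^\infty c_n(1-x)^n\right\}.$$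
   Context: $(a)_n=\Gamma(a+n)/\Gamma(a)=a(a+1)\cdots(a+n-1)$ denotes the Pochhammer symbol; $\nabla$ acts on the argument $\gamma$ (so $\nabla^k$ is its $k$-fold iterate). A density function is a nonnegative integrable function on $[0,1]$ with integral 1. *)

(* Defs.v *)
From HB Require Import structures.
From mathcomp Require Import all_boot all_order all_algebra.
From mathcomp Require Import all_classical all_reals all_analysis.
Set Implicit Arguments. Unset Strict Implicit. Unset Printing Implicit Defensive.
Import Order.TTheory GRing.Theory Num.Theory.
Local Open Scope ring_scope.
Local Open Scope classical_set_scope.

Section Defs.
Variable R : realType.

Definition poch (a : R) (n : nat) : R := \prod_(j < n) (a + j%:R).

Definition Gamma (s : R) : R :=
  Rintegral (@lebesgue_measure R) `]0, +oo[ (fun t => t `^ (s - 1) * expR (- t)).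

Definition nabla (g : R -> R) : R -> R := fun c => g c - g (c - 1).

Variables (m : nat) (u v : 'I_m -> R).

Definition delta : R := \sum_(i < m) (v i - u i).
Definition pp (c : R) : R := \prod_(i < m) (c + 1 - u i).
Definition qq (c : R) : R := \prod_(i < m) (c + 2 - v i).
Definition qq1 (c : R) : R := (1 + c) * qq c - c * qq (c - 1).

Definition Rp (k : nat) (g : R) : R :=
  (k`!%:R)^-1 * iter k nabla pp g - (k.+1`!%:R)^-1 * iter k nabla qq1 g.

(* value c_{n-k} read from the history hist = [c_0; ...; c_{n-1}], 0 if n-k < 0 *)
Definition cget (hist : seq R) (n k : nat) : R :=
  if (k <= n)%N then nth 0 hist (n - k) else 0.

Definition cnext (hist : seq R) (n : nat) : R :=
  (n%:R)^-1 * \sum_(1 <= k < (minn (m - 1) n).+1)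
      (poch (- n%:R - delta + 1) k)^-1 * Rp (m - 1 - k) (n%:R - k%:R + delta - 1)
      * cget hist n k
  + (n%:R * poch (- n%:R - delta + 1) (m - 1))^-1
      * qq (n%:R - m%:R + delta - 1) * cget hist n m.

Fixpoint chist (n : nat) : seq R :=
  match n with
  | 0 => [:: 1]
  | n'.+1 => rcons (chist n') (cnext (chist n') n'.+1)
  end.

Definition cc (n : nat) : R := nth 0 (chist n) n.

End Defs.

(* Main.v *)
Require Import Defs.
From HB Require Import structures.
From mathcomp Require Import all_boot all_order all_algebra.
From mathcomp Require Import all_classical all_reals all_analysis.
From mathcomp Require Import measurable_realfun ring lra zify.
Import Order.TTheory GRing.Theory Num.Theory.
Import numFieldNormedType.Exports.
Local Open Scope ring_scope.
Local Open Scope classical_set_scope.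

(** The density is that of a product of independent beta variables of parameters
    u_i and v_i - u_i. Multiplying by one more beta variable is a Mellin convolution,
    and Tonelli's theorem multiplies the moments. Put y = 1 - x. In a convolution
    with a beta variable of parameters w and d = z - w, the function
    F = y^(delta - 1) sum_n a_n y^n becomes, up to a constant, x^(w - 1) I^d x^(1 - z) F,
    where I^d is the fractional integral of order d in y; integrating termwise and
    expanding the powers of x in binomial series shows that the new density again
    has the form y^(delta + d - 1) sum_n b_n y^n.

    To identify the coefficients, let theta = x d/dx. The densities satisfy
    prod_i (theta - (u_i - 1)) f = x prod_i (theta - (v_i - 2)) f, and this is
    proved by induction on m directly on coefficient sequences, from the commutation
    rules theta x^al = x^al (theta + al) and from the action of I^d. On powers of y,
    a polynomial p(theta) acts through the backward differences nabla^k p / k!, so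
    that comparing coefficients gives the recursion defining c_n. *)

(** * The operator theta = x d/dx and powers of x on coefficient sequences *)

Section theta_operators.
Context {R : realType}.
Implicit Types (g p al : R) (a b : int -> R) (P Q : seq R) (n : int) (k K : nat).

(* A sequence [a] stands for the sum of the [a n * y ^ (n + g - 1) / Gamma (n + g)]
   with x = 1 - y; [thetaB g p] is then the operator x d/dx - p, and [mulY], [mulX]
   are the multiplications by y and x. Since d/dy is a shift in this basis, the
   operators make sense for every g, including the integers, and the fractional
   integral of order d only replaces g by g + d. *)
Definition thetaB g p a n : R := (n%:~R + g - 1 - p) * a n - a (n + 1).
Definition mulY g a n : R := (n%:~R + g - 1) * a (n - 1).
Definition mulX g a n : R := a n - mulY g a n.
Definition thetaP g P a : int -> R := foldr (thetaB g) a P.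
(** The equation prod (theta - p) f = x prod (theta - q) f. Negative indices matter: the recurrence
    is later read at an index n - (m - 1) that may be negative. *)
Definition hypergeom_eq g P Q a :=
  forall n, thetaP g P a n = mulX g (thetaP g Q a) n.

(** Coefficient of y^k in (1 - y)^(-c). *)
Definition binc (c : R) k : R := poch c k / k`!%:R.

Lemma bincS c k : k.+1%:R * binc c k.+1 = (c + k%:R) * binc c k.
Proof.
rewrite /binc /poch big_ord_recr/= factS natrM.
have k1 : k.+1%:R != 0 :> R by rewrite pnatr_eq0.
have k2 : k`!%:R != 0 :> R by rewrite pnatr_eq0 -lt0n fact_gt0.
by field; rewrite k2/= addrC natr1.
Qed.

Lemma mulY_sub g a b c n :
  mulY g (fun i => a i - c * b i) n = mulY g a n - c * mulY g b n.
Proof. by rewrite /mulY; ring. Qed.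

Lemma eq_mulY g a b : a =1 b -> mulY g a =1 mulY g b.
Proof. by move=> ab n; rewrite /mulY ab. Qed.

Lemma eq_iter_mulY g k a b : a =1 b -> iter k (mulY g) a =1 iter k (mulY g) b.
Proof. by move=> ab; elim: k => //= k IH; exact: eq_mulY. Qed.

Lemma iter_mulY_sub g k a b c n :
  iter k (mulY g) (fun i => a i - c * b i) n =
  iter k (mulY g) a n - c * iter k (mulY g) b n.
Proof.
elim: k n => //= k IH n; rewrite -mulY_sub; exact: eq_mulY.
Qed.

Lemma iter_mulYE g k a n :
  iter k (mulY g) a n = (\prod_(j < k) (n%:~R + g - 1 - j%:R)) * a (n - k%:Z).
Proof.
elim: k n => [|k IH] n /=; first by rewrite big_ord0 mul1r subr0.
rewrite big_ord_recl/= /mulY IH subr0 mulrA; congr (_ * _ * a _); last by lia.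
apply: eq_bigr => i _; rewrite /bump/= rmorphB/= -natr1; ring.
Qed.

(** Leibniz rule, since theta y = -x = y - 1. *)
Lemma thetaB_mulY g p a n :
  thetaB g p (mulY g a) n = mulY g (thetaB g p a) n + mulY g a n - a n.
Proof.
rewrite /thetaB /mulY addrK subrK !rmorphB !rmorphD/=; ring.
Qed.

Lemma thetaB_iter_mulY g p k a n :
  thetaB g p (iter k (mulY g) a) n =
  iter k (mulY g) (thetaB g p a) n
  + k%:R * iter k (mulY g) a n - k%:R * iter k.-1 (mulY g) a n.
Proof.
elim: k n => [|k IH] n /=; first by rewrite !mul0r addr0 subr0.
rewrite thetaB_mulY (eq_mulY _ _ _ IH).
have -> : mulY g (fun n => iter k (mulY g) (thetaB g p a) n
   + k%:R * iter k (mulY g) a n - k%:R * iter k.-1 (mulY g) a n) n =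
   mulY g (iter k (mulY g) (thetaB g p a)) n
   + k%:R * mulY g (iter k (mulY g) a) n - k%:R * mulY g (iter k.-1 (mulY g) a) n.
  by rewrite /mulY; ring.
case: k {IH} => [|k] /=; rewrite -?natr1; ring.
Qed.

(* [b] is the product of [a] by x ^ al = (1 - y) ^ al; the expansion in powers of y
   is finite at every index because [a] vanishes below [- L]. *)
Definition mulXpow g al L a b :=
  (forall n, n < - L -> a n = 0) /\
  (forall n K, n + L < K%:Z ->
    b n = \sum_(k < K) binc (- al) k * iter k (mulY g) a n).

Lemma mulXpow_weaken g al (L L' : int) a b : L <= L' ->
  mulXpow g al L a b -> mulXpow g al L' a b.
Proof.
move=> LL' [a0 bE]; split=> [n nL|n K nK]; [apply: a0|apply: bE]; lia.
Qed.

Lemma mulXpow_unique g al (L L' : int) a a' b b' : a =1 a' ->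
  mulXpow g al L a b -> mulXpow g al L' a' b' -> b =1 b'.
Proof.
move=> aa' [_ bE] [_ b'E] n; have [K nK] : exists K, n + L < K%:Z /\ n + L' < K%:Z.
  by exists (absz (n + L)%R + absz (n + L')%R).+1; lia.
rewrite (bE n K) ?(b'E n K); [|lia..].
by apply: eq_bigr => k _; rewrite (eq_iter_mulY _ _ _ _ aa').
Qed.

Lemma mulXpow_mulX g al (L : int) a b :
  mulXpow g al L a b -> mulXpow g al L (mulX g a) (mulX g b).
Proof.
move=> [a0 bE]; split=> [n nL|n K nK].
  by rewrite /mulX /mulY !a0 ?mulr0 ?subr0//; lia.
rewrite [LHS]/mulX [mulY g b n]/mulY (bE n K) ?(bE (n - 1) K); [|lia..].
rewrite mulr_sumr -sumrB; apply: eq_bigr => k _.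
transitivity (binc (- al) k * (iter k (mulY g) a n - 1 * iter k (mulY g) (mulY g a) n)).
  by rewrite -iterSr iterS [X in _ = _ * (_ - _ * X)]/mulY; ring.
by rewrite -iter_mulY_sub; congr (_ * _); apply: eq_iter_mulY => i; rewrite mul1r.
Qed.

(** This is (theta - p - al) x^al = x^al (theta - p). In the expansion of x^al, the extra terms of
    the Leibniz rule telescope by [bincS]. The bound grows by 1 because [thetaB] reads index n +
    1. *)
Lemma mulXpow_thetaB g al (L : int) p a b : mulXpow g al L a b ->
  mulXpow g al (L + 1) (thetaB g p a) (thetaB g (p + al) b).
Proof.
move=> [a0 bE]; split=> [n nL|n K nK].
  by rewrite /thetaB !a0 ?mulr0 ?subr0//; lia.
have -> : thetaB g (p + al) b n = \sum_(k < K)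
    binc (- al) k * thetaB g (p + al) (iter k (mulY g) a) n.
  rewrite /thetaB (bE n K) ?(bE (n + 1) K); [|lia..].
  by rewrite mulr_sumr -sumrB; apply: eq_bigr => k _; ring.
pose e k := k%:R * binc (- al) k * iter k.-1 (mulY g) a n.
have -> : \sum_(k < K) binc (- al) k * thetaB g (p + al) (iter k (mulY g) a) n =
    \sum_(k < K) (binc (- al) k * iter k (mulY g) (thetaB g p a) n
                 + (e k.+1 - e k)).
  apply: eq_bigr => k _; rewrite /e /= bincS.
  rewrite (_ : thetaB _ _ _ _ = thetaB g p (iter k (mulY g) a) n
     - al * iter k (mulY g) a n); last by rewrite /thetaB; ring.
  rewrite thetaB_iter_mulY; ring.
rewrite big_split/= [X in _ + X](_ : _ = 0) ?addr0//.
rewrite -(big_mkord xpredT (fun k => e k.+1 - e k)) telescope_sumr//.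
(* The upper end of the telescope reads [a] below [- L], thanks to the enlarged bound. *)
rewrite /e !mul0r subr0; case: K nK => [|K] nK; first by rewrite !mul0r.
by rewrite /= iter_mulYE a0 ?mulr0//; lia.
Qed.

Lemma mulXpow_thetaP g al (L : int) P a b : mulXpow g al L a b ->
  mulXpow g al (L + (size P)%:Z) (thetaP g P a) (thetaP g [seq p + al | p <- P] b).
Proof.
move=> ab; elim: P => [|p P IH] /=; first by rewrite addr0.
apply: mulXpow_weaken (mulXpow_thetaB _ _ _ p _ _ IH); lia.
Qed.

Lemma hypergeom_eq_mulXpow g al (L : int) P Q a b : mulXpow g al L a b ->
  hypergeom_eq g P Q a ->
  hypergeom_eq g [seq p + al | p <- P] [seq q + al | q <- Q] b.
Proof.
move=> ab aE; apply: mulXpow_unique aE (mulXpow_thetaP _ _ _ P _ _ ab) _.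
exact/mulXpow_mulX/mulXpow_thetaP/ab.
Qed.

(** The fractional integral of order d keeps the sequence and replaces g by g + d; [thetaB] depends
    on g and p only through g - p. *)
Lemma thetaP_shift g d P a :
  thetaP g P a =1 thetaP (g + d) [seq p + d | p <- P] a.
Proof.
elim: P => //= p P IH n; rewrite /thetaB !IH; congr (_ * _ - _); ring.
Qed.

(** Multiplication by x depends on g, hence does not commute with the fractional integral. One more
    factor repairs this: theta after the old x equals the new x after theta - (d - 1). *)
Lemma hypergeom_eq_shift g d P Q a : hypergeom_eq g P Q a ->
  hypergeom_eq (g + d) (0 :: [seq p + d | p <- P]) (d - 1 :: [seq q + d | q <- Q]) a.
Proof.
move=> aE n; set P' := map _ P; set Q' := map _ Q.
rewrite -[LHS]/(thetaB (g + d) 0 (thetaP (g + d) P' a) n).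
rewrite -[thetaP _ (_ :: _) _]/(thetaB (g + d) (d - 1) (thetaP (g + d) Q' a)).
rewrite /mulX /mulY /thetaB -!thetaP_shift !aE /mulX /mulY.
by rewrite addrK subrK !rmorphB !rmorphD/=; ring.
Qed.

(** The shifts 1 - v, v - u and u - 1 of the old roots add up to 0; the new roots 0 and v - u - 1
    are moved by u - 1 only. *)
Lemma hypergeom_eq_beta g u v P Q a c b L L' :
  mulXpow g (1 - v) L a c -> mulXpow (g + (v - u)) (u - 1) L' c b ->
  hypergeom_eq g P Q a ->
  hypergeom_eq (g + (v - u)) (u - 1 :: P) (v - 2 :: Q) b.
Proof.
move=> ac cb aE.
have := hypergeom_eq_mulXpow _ _ _ _ _ _ _ cb
  (hypergeom_eq_shift _ (v - u) _ _ _ (hypergeom_eq_mulXpow _ _ _ _ _ _ _ ac aE)).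
move=> /= bE n; move: (bE n).
rewrite -!map_comp !(@eq_map _ _ _ id) ?map_id => [|p /=|p /=]; [|ring..].
by rewrite add0r (_ : v - u - 1 + (u - 1) = v - 2)//; ring.
Qed.

End theta_operators.

(** * From the equation to a recurrence, through backward differences *)

Section recursion.
Context {R : realType}.
Implicit Types (g p al : R) (a b : int -> R) (P Q : seq R) (n : int) (k K : nat).

Definition linprod P (c : R) : R := \prod_(p <- P) (c - p).

Lemma eq_iter_nabla k (f1 f2 : R -> R) : f1 =1 f2 ->
  iter k (@nabla R) f1 =1 iter k (@nabla R) f2.
Proof. by move=> /funext ->. Qed.

(** Leibniz rule for differences: those of order at least 2 of the linear factor vanish. *)
Lemma iter_nabla_mull k p (f : R -> R) c :
  iter k (@nabla R) (fun x => (x - p) * f x) c =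
  (c - k%:R - p) * iter k (@nabla R) f c + k%:R * iter k.-1 (@nabla R) f c.
Proof.
elim: k c => [|k IH] c; first by rewrite /= mul0r addr0 subr0.
rewrite iterS /nabla !IH.
case: k {IH} => [|k] /=; first by rewrite /nabla; ring.
by rewrite /nabla -[k.+2%:R]natr1; ring.
Qed.

Lemma iter_nabla_linprod_cons k p P c :
  iter k (@nabla R) (linprod (p :: P)) c =
  (c - k%:R - p) * iter k (@nabla R) (linprod P) c
  + k%:R * iter k.-1 (@nabla R) (linprod P) c.
Proof.
rewrite -iter_nabla_mull; apply: eq_iter_nabla => x.
by rewrite /linprod big_cons.
Qed.

Lemma iter_nabla_linprod_gt k P c : (size P < k)%N ->
  iter k (@nabla R) (linprod P) c = 0.
Proof.
elim: P k c => [|p P IH] [//|k] c /= kP.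
  rewrite -/(iter k.+1 (@nabla R) (linprod [::]) c) iterSr.
  rewrite (_ : nabla _ = fun=> 0); last first.
    by apply/funext => x; rewrite /nabla /linprod !big_nil subrr.
  by elim: k c {kP} => //= k IHk c; rewrite /nabla !IHk subrr.
rewrite -iterS iter_nabla_linprod_cons (IH k.+1) ?(IH k.+1.-1) ?mulr0 ?addr0//; lia.
Qed.

Definition ndiff k (f : R -> R) c : R := (k`!%:R)^-1 * iter k (@nabla R) f c.

Lemma ndiff_linprod_cons k p P c : ndiff k.+1 (linprod (p :: P)) c =
  (c - k.+1%:R - p) * ndiff k.+1 (linprod P) c + ndiff k (linprod P) c.
Proof.
rewrite /ndiff iter_nabla_linprod_cons/= factS natrM.
have k1 : k.+1%:R != 0 :> R by rewrite pnatr_eq0.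
have k2 : k`!%:R != 0 :> R by rewrite pnatr_eq0 -lt0n fact_gt0.
rewrite -(natr1 k) in k1 *.
by field; rewrite k2 natr1 pnatr_eq0.
Qed.

Lemma ndiff0 (f : R -> R) c : ndiff 0 f c = f c.
Proof. by rewrite /ndiff fact0 invr1 mul1r. Qed.

Lemma ndiff_gt k P c : (size P < k)%N -> ndiff k (linprod P) c = 0.
Proof. by move=> kP; rewrite /ndiff iter_nabla_linprod_gt ?mulr0. Qed.

Lemma ndiff_size P c : ndiff (size P) (linprod P) c = 1.
Proof.
elim: P => [|p P IH] /=; first by rewrite ndiff0 /linprod big_nil.
by rewrite ndiff_linprod_cons IH ndiff_gt// mulr0 add0r.
Qed.

Lemma ndiff_size_pred p P c : ndiff (size P) (linprod (p :: P)) c =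
  \sum_(j < (size P).+1) (c - j%:R) - \sum_(x <- p :: P) x.
Proof.
elim: P p => [|q P IH] p.
  by rewrite ndiff0 /linprod !big_cons !big_nil big_ord1/=; ring.
rewrite /= ndiff_linprod_cons (ndiff_size (q :: P)) IH.
by rewrite [in RHS]big_ord_recr/= [in RHS]big_cons; ring.
Qed.

(** On coefficients, theta is the diagonal operator n + g - 1 minus the shift to index n + 1. Moving
    k shifts to the right turns the polynomial into its k-th difference over k!;
    [ndiff_linprod_cons] is the induction step. *)
Lemma thetaPE g P a n K : (size P < K)%N -> thetaP g P a n =
  \sum_(k < K) (-1) ^+ k * ndiff k (linprod P) (n%:~R + g - 1 + k%:R) * a (n + k%:Z).
Proof.
elim: P n K => [|p P IH] n K /= PK.
  case: K PK => // K _; rewrite big_ord_recl/= big1 ?addr0 => [|k _]; last first.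
    by rewrite ndiff_gt// mulr0 mul0r.
  by rewrite ndiff0 /linprod big_nil expr0 !mul1r.
rewrite /thetaB (IH _ K)// 1?ltnW// (IH _ K.-1); last by lia.
case: K PK => // K PK /=; rewrite [in RHS]big_ord_recl [in LHS]big_ord_recl /=.
rewrite !ndiff0 mulrDr mulr_sumr -addrA -sumrB; congr (_ + _).
  by rewrite /linprod big_cons !addr0; ring.
apply: eq_bigr => k _; rewrite /bump/= !add1n ndiff_linprod_cons.
rewrite (_ : (n + 1 + k = n + k.+1%:Z)); last by lia.
rewrite (_ : (n + 1)%:~R + g - 1 + k%:R = n%:~R + g - 1 + k.+1%:R); last first.
  by rewrite rmorphD/= -natr1; ring.
by rewrite exprS; ring.
Qed.

(** R'_k in terms of the root lists, as [RpE] shows. The last term comes from the y in x = 1 - y,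
    whence its order k + 1. *)
Definition ddR k P Q c : R :=
  ndiff k (linprod P) c - ndiff k (linprod Q) c - (c - k%:R) * ndiff k.+1 (linprod Q) c.

(** Both differences of order m - 1 contain the same sum of the c - j, which cancels and leaves the
    sums of the roots. *)
Lemma ddR_size_pred P Q c : size P = size Q -> (0 < size P)%N ->
  ddR (size P).-1 P Q c =
  \sum_(x <- Q) x - \sum_(x <- P) x - (c - (size P).-1%:R).
Proof.
case: P Q => [//|p P] [//|q Q] [PQ] _; rewrite /ddR /=.
have -> : ndiff (size P).+1 (linprod (q :: Q)) c = 1 by rewrite PQ (ndiff_size (q :: Q)).
have -> : ndiff (size P) (linprod (q :: Q)) c =
    \sum_(j < (size P).+1) (c - j%:R) - \sum_(x <- q :: Q) x.
  by rewrite PQ ndiff_size_pred.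
by rewrite ndiff_size_pred; ring.
Qed.

(** Comparison of coefficients at index n. The terms k = m cancel, both products being monic of
    degree m; the first term of the expansion at n - 1 has no partner and stays apart. *)
Lemma hypergeom_eq_rec g P Q a n : size P = size Q -> hypergeom_eq g P Q a ->
  \sum_(k < size P) (-1) ^+ k * ddR k P Q (n%:~R + g - 1 + k%:R) * a (n + k%:Z)
  + (n%:~R + g - 1) * linprod Q (n%:~R + g - 2) * a (n - 1) = 0.
Proof.
move=> PQ /(_ n); rewrite /mulX /mulY; set m := size P.
have mQ : (size Q < m.+1)%N by rewrite /m PQ.
rewrite (thetaPE _ P _ _ m.+1)// (thetaPE _ Q _ n m.+1)//.
rewrite (thetaPE _ Q _ (n - 1) m.+2) 1?ltnW//.
rewrite [X in _ - _ * X]big_ord_recl/= ndiff0 !addr0 expr0 mul1r => /eqP.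
rewrite -subr_eq0 => /eqP aE; rewrite -[RHS]aE.
transitivity (\sum_(k < m.+1) (-1) ^+ k * ddR k P Q (n%:~R + g - 1 + k%:R) * a (n + k%:Z)
  + (n%:~R + g - 1) * linprod Q (n%:~R + g - 2) * a (n - 1)).
  rewrite big_ord_recr/= [ddR m P Q _](_ : _ = 0); last first.
    by rewrite /ddR ndiff_size (ndiff_gt m.+1)// /m PQ ndiff_size; ring.
  by rewrite mulr0 mul0r addr0.
rewrite opprB addrA addrAC -sumrB mulrDr addrA mulr_sumr addrAC -big_split/=.
congr (_ + _).
  apply: eq_bigr => k _; rewrite /bump/= add1n /ddR.
  rewrite (_ : (n - 1 + k.+1%:Z = n + k)); last by lia.
  rewrite (_ : (n - 1)%:~R + g - 1 + k.+1%:R = n%:~R + g - 1 + k%:R); last first.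
    by rewrite rmorphB/= -natr1; ring.
  by rewrite exprS; ring.
by rewrite mulrA; congr (_ * linprod _ _ * _); rewrite rmorphB/=; ring.
Qed.

End recursion.

(** * Pochhammer identities *)

Section pochhammer.
Context {R : realType}.
Implicit Types (g : R) (n k : nat).

Lemma poch0 g : poch g 0 = 1. Proof. by rewrite /poch big_ord0. Qed.

Lemma pochS g n : poch g n.+1 = poch g n * (g + n%:R).
Proof. by rewrite /poch big_ord_recr. Qed.

Lemma poch_gt0 g n : 0 < g -> 0 < poch g n.
Proof. by move=> g0; apply: prodr_gt0 => i _; rewrite ltr_wpDr. Qed.

Lemma poch_sub g n k : (k <= n)%N ->
  poch g n = poch g (n - k) * \prod_(j < k) (n%:R + g - 1 - j%:R).
Proof.
elim: k => [|k IH] kn; first by rewrite big_ord0 mulr1 subn0.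
rewrite IH 1?ltnW// big_ord_recr/= mulrA (mulrAC (poch _ _)) subnS.
case: (n - k)%N (subnKC (ltnW kn)) => [|j] nE; first by lia.
by rewrite pochS/=; congr (_ * _ * _); rewrite -nE natrD -natr1; ring.
Qed.

Lemma poch_opp g n k :
  \prod_(j < k) (n%:R + g - 1 - j%:R) = (-1) ^+ k * poch (- n%:R - g + 1) k.
Proof.
elim: k => [|k IH]; first by rewrite poch0 big_ord0 mulr1.
by rewrite big_ord_recr/= IH pochS exprS; ring.
Qed.

End pochhammer.

(** * Identification of the coefficients with [cc] *)

Section coefficients.
Context {R : realType} {m : nat} (u v : 'I_m -> R).
Implicit Types (g : R) (c : nat -> R) (n k : nat).

(* the sequence standing for Gamma(g)^-1 times the sum of the c n * y ^ (n + g - 1) *)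
Definition hat g c (n : int) : R := if n is Posz k then poch g k * c k else 0.

(** Source of the factors 1 / (-n - delta + 1)_k in c_n: the quotient (g)_n / (g)_(n-k) is (-1)^k
    (-n - g + 1)_k. For k > n both sides are 0, even if that symbol vanishes. *)
Lemma hat_sub g c n k : 0 < g -> (-1) ^+ k * hat g c (n%:Z - k%:Z) =
  poch g n * (poch (- n%:R - g + 1) k)^-1 * (if (k <= n)%N then c (n - k)%N else 0).
Proof.
move=> g0; case: ifPn => [kn|nk]; last first.
  rewrite mulr0 (_ : n%:Z - k%:Z = Negz (k - n).-1) ?mulr0//.
  by rewrite NegzE; lia.
rewrite subzn//= (poch_sub _ _ _ kn) poch_opp.
have /lt0r_neq0 := poch_gt0 g n g0; rewrite (poch_sub _ _ _ kn) poch_opp.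
rewrite mulf_eq0 mulf_eq0 !negb_or => /and3P[? ? ?].
by field.
Qed.

Lemma size_chist n : size (chist u v n) = n.+1.
Proof. by elim: n => //= n IH; rewrite size_rcons IH. Qed.

Lemma nth_chist n k : (k <= n)%N -> nth 0 (chist u v n) k = cc u v k.
Proof.
elim: n => [|n IH]; first by case: k.
rewrite leq_eqVlt => /predU1P[->//|kn].
by rewrite /= nth_rcons size_chist kn IH.
Qed.

(** As [cz] vanishes beyond n + 1, the sum may run up to m - 1 without the minimum. *)
Lemma ccS n (cz := fun k => if (k <= n.+1)%N then cc u v (n.+1 - k) else 0) :
  (0 < m)%N ->
  cc u v n.+1 = (n.+1%:R)^-1 * (\sum_(1 <= k < m)
      (poch (- n.+1%:R - delta u v + 1) k)^-1 *
      Rp u v (m - 1 - k) (n.+1%:R - k%:R + delta u v - 1) * cz k) +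
  (n.+1%:R * poch (- n.+1%:R - delta u v + 1) (m - 1))^-1
      * qq v (n.+1%:R - m%:R + delta u v - 1) * cz m.
Proof.
move=> m0.
have czE k : (0 < k)%N -> cget (chist u v n) n.+1 k = cz k.
  by move=> k0; rewrite /cget /cz; case: ifP => // kn; rewrite nth_chist//; lia.
rewrite /cc /= nth_rcons size_chist ltnn eqxx /cnext czE//; congr (_ * _ + _).
rewrite (@big_cat_nat _ _ _ (minn (m - 1) n.+1).+1 1 m)//=; last by lia.
rewrite [X in _ = _ + X]big_nat_cond [X in _ = _ + X]big1 ?addr0.
  by apply: eq_big_nat => k k1; rewrite czE//; lia.
by move=> k km; rewrite /cz ifF ?mulr0//; lia.
Qed.

Let P := [seq u i - 1 | i <- enum 'I_m].
Let Q := [seq v i - 2 | i <- enum 'I_m].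

Lemma linprod_pp : linprod P = pp u.
Proof.
apply/funext => x; rewrite /linprod /pp big_map big_enum/=.
by apply: eq_bigr => i _; ring.
Qed.

Lemma linprod_qq : linprod Q = qq v.
Proof.
apply/funext => x; rewrite /linprod /qq big_map big_enum/=.
by apply: eq_bigr => i _; ring.
Qed.

(** Here q_1 is the backward difference of (c + 1) q(c), so the Leibniz rule applies. *)
Lemma RpE k (x : R) : Rp u v k x = ddR k P Q x.
Proof.
rewrite /Rp /ddR /ndiff linprod_pp linprod_qq -addrA; congr (_ + _).
have -> : qq1 v = nabla (fun x => (x - (-1)) * qq v x).
  by apply/funext => y; rewrite /qq1 /nabla; ring.
rewrite -iterSr iter_nabla_mull/= factS natrM.
have k1 : k.+1%:R != 0 :> R by rewrite pnatr_eq0.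
have k2 : k`!%:R != 0 :> R by rewrite pnatr_eq0 -lt0n fact_gt0.
rewrite -[k.+1%:R]natr1 in k1 *.
by field; rewrite k2 natr1 pnatr_eq0.
Qed.


(** Strong induction: the recurrence determines c_(n+1) from the earlier terms, its top coefficient
    being -(n + 1). *)
Lemma hypergeom_eq_cc c : (0 < m)%N -> 0 < delta u v -> c 0%N = 1 ->
  hypergeom_eq (delta u v) P Q (hat (delta u v) c) -> c =1 cc u v.
Proof.
move=> m0 g0 c0 cE; set g := delta u v in g0 cE *.
have [sP sQ] : size P = m /\ size Q = m by rewrite /P /Q 2!size_map size_enum_ord.
have ddR_pred x : ddR m.-1 P Q x = g - 1 - x.
  rewrite -sP ddR_size_pred ?sP ?sQ//.
  rewrite /P /Q big_map big_enum big_map big_enum/= -sumrB (_ : \sum_(i < m) _ = g - m%:R).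
    by rewrite -[in m%:R](prednK m0) -natr1; ring.
  rewrite (_ : m%:R = \sum_(i < m) (1 : R)); last by rewrite sumr_const card_ord.
  rewrite /g /delta -sumrB.
  by apply: eq_bigr => i _; ring.
move=> n; elim/ltn_ind: n => -[//|n] IH.
pose cz k := if (k <= n.+1)%N then c (n.+1 - k)%N else 0.
have czE k : (0 < k)%N ->
    (if (k <= n.+1)%N then cc u v (n.+1 - k) else 0) = cz k.
  by move=> k0; rewrite /cz; case: ifP => // kn; rewrite IH//; lia.
rewrite ccS// czE//.
have -> : \sum_(1 <= k < m) (poch (- n.+1%:R - delta u v + 1) k)^-1 *
    Rp u v (m - 1 - k) (n.+1%:R - k%:R + delta u v - 1) *
    (if (k <= n.+1)%N then cc u v (n.+1 - k) else 0) =
    \sum_(1 <= k < m) (poch (- n.+1%:R - g + 1) k)^-1 *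
    ddR (m - 1 - k) P Q (n.+1%:R - k%:R + g - 1) * cz k.
  by apply: eq_big_nat => k /andP[k1 _]; rewrite czE// RpE.
have n0 : n.+1%:R != 0 :> R by rewrite pnatr_eq0.
have p0 : poch g n.+1 != 0 by rewrite gt_eqF// poch_gt0.
(* At this index the highest term of the recurrence is the one of index n + 1. *)
have := hypergeom_eq_rec _ _ _ _ (n.+1%:Z - m.-1%:Z) _ cE.
rewrite sP sQ => /(_ erefl) /(congr1 (fun x => (-1) ^+ m.-1 * x)).
rewrite mulr0 mulrDr linprod_qq.
(* The factor n + 1 - m + g from the multiplication by y cancels, up to sign, the last factor of (-n
   - g)_m; hence the symbol of order m - 1 in the last term of c_n. *)
have -> : (-1) ^+ m.-1 * ((((n.+1%:Z - m.-1%:Z)%:~R + g - 1) *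
    qq v ((n.+1%:Z - m.-1%:Z)%:~R + g - 2)) * hat g c (n.+1%:Z - m.-1%:Z - 1)) =
    poch g n.+1 * (poch (- n.+1%:R - g + 1) (m - 1))^-1 *
      qq v (n.+1%:R - m%:R + g - 1) * cz m.
  rewrite (_ : n.+1%:Z - m.-1%:Z - 1 = n.+1%:Z - m%:Z); last by lia.
  have -> : (n.+1%:Z - m.-1%:Z)%:~R = n.+1%:R - m%:R + 1 :> R.
    by rewrite rmorphB/= -[m in RHS](prednK m0) -[in RHS]natr1; ring.
  have := hat_sub g c n.+1 m g0; rewrite -/(cz m); have [mn|nm] := leqP m n.+1; last first.
    move=> _; rewrite /cz leqNgt nm !mulr0.
    by rewrite (_ : n.+1%:Z - m%:Z = Negz (m - n.+1).-1) ?mulr0//; rewrite NegzE; lia.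
  rewrite (_ : poch _ m = poch (- n.+1%:R - g + 1) (m - 1) * - (n.+1%:R - m%:R + g)); last first.
    rewrite -[in poch _ m](prednK m0) pochS subn1; congr (_ * _).
    by rewrite -[in RHS](prednK m0) -[in RHS](natr1 m.-1); ring.
  have t0 : n.+1%:R - m%:R + g != 0 by rewrite -natrB// gt_eqF// ltr_wpDl.
  rewrite -[in (-1) ^+ m](prednK m0) exprS mulN1r mulNr => /eqP; rewrite eqr_oppLR => /eqP hE.
  have {}hE : (-1) ^+ m.-1 * (n.+1%:R - m%:R + g) * hat g c (n.+1%:Z - m%:Z) =
      poch g n.+1 / poch (- n.+1%:R - g + 1) (m - 1) * cz m.
    by rewrite mulrAC hE invfM; move: (_ (m - 1)%N)^-1 (_ + g) t0 => y t t0; field.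
  rewrite (_ : _ + 1 + g - 2 = n.+1%:R - m%:R + g - 1); last by ring.
  rewrite (_ : _ + 1 + g - 1 = n.+1%:R - m%:R + g); last by ring.
  by rewrite [RHS]mulrAC -hE; ring.
pose F i := poch g n.+1 * ((poch (- n.+1%:R - g + 1) i)^-1 *
  ddR (m - 1 - i) P Q (n.+1%:R - i%:R + g - 1) * cz i).
(* After reversal, i counts the steps back from index n + 1. *)
rewrite [X in X + _ = _ -> _]mulr_sumr (reindex_inj rev_ord_inj)/= (eq_bigr (fun i : 'I_m => F i)); last first.
  move=> i _; rewrite /F (_ : (m - 1 - i = m - i.+1)%N); last by lia.
  transitivity (ddR (m - i.+1) P Q (n.+1%:R - i%:R + g - 1) *
    ((-1) ^+ i * hat g c (n.+1%:Z - i%:Z))); last by rewrite hat_sub// -/(cz i); ring.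
  have -> : (-1) ^+ i = (-1) ^+ m.-1 * (-1) ^+ (m - i.+1) :> R.
    rewrite -exprD -signr_odd -[RHS]signr_odd; congr (_ ^+ nat_of_bool _).
    by have := ltn_ord i; lia.
  rewrite (_ : n.+1%:Z - m.-1%:Z + (m - i.+1)%:Z = n.+1%:Z - i%:Z); last first.
    by have := ltn_ord i; lia.
  rewrite (_ : (n.+1%:Z - m.-1%:Z)%:~R + g - 1 + (m - i.+1)%:R =
               n.+1%:R - i%:R + g - 1).
    move: ((-1) ^+ m.-1) ((-1) ^+ (m - i.+1)) => s t; ring.
  rewrite natrB// rmorphB/= -pmulrn -[in m%:R](prednK m0) -(natr1 i) -(natr1 m.-1).
  by ring.
rewrite -(big_mkord xpredT F) big_ltn// /F -mulr_sumr poch0 invr1 mul1r.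
rewrite subn0 subn1 ddR_pred subr0 [cz 0%N]/cz/= subn0.
set S := \sum_(_ <= _ < _) _; set qz := qq v _; move=> cnE.
rewrite invfM -/g; move: cnE; move: (poch _ m.-1)^-1 => y cnE.
have {}cnE : poch g n.+1 * (S + y * qz * cz m - n.+1%:R * c n.+1) = 0.
  by rewrite -[RHS]cnE; ring.
move: cnE => /eqP; rewrite mulf_eq0 (negPf p0)/= subr_eq0 => /eqP cnE.
by apply: (mulfI n0); rewrite -cnE; move: (n.+1%:R) n0 => t t0; field.
Qed.

End coefficients.

(** * Cauchy products and power series of radius at least 1 *)

Section cauchy_product.
Context {R : realType}.
Implicit Types (x y : R^nat) (n k : nat).

Definition cauchyM x y n : R := \sum_(k < n.+1) x k * y (n - k)%N.

Lemma series_cauchy x y n :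
  series (cauchyM x y) n = \sum_(i < n) x i * series y (n - i)%N.
Proof.
elim: n => [|n IH]; first by rewrite /series/= big_nil big_ord0.
rewrite seriesSr IH.
rewrite [cauchyM x y n]/cauchyM !big_ord_recr/= addrA -big_split/= subnn subSn// subnn.
congr (_ + _); last by rewrite /series/= big_nat1.
apply: eq_bigr => i _; rewrite subSn; last exact: ltnW.
by rewrite /series/= [in RHS]big_nat_recr//= mulrDr.
Qed.

Lemma norm_cauchy_le x y n :
  `|cauchyM x y n| <= cauchyM (fun k => `|x k|) (fun k => `|y k|) n.
Proof.
by rewrite (le_trans (ler_norm_sum _ _ _))// ler_sum// => i _; rewrite normrM.
Qed.

Lemma series_ge0 x n : (forall k, 0 <= x k) -> 0 <= series x n.
Proof. by move=> x0; rewrite /series/=; apply: sumr_ge0. Qed.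

Lemma series_le x n k : (forall k, 0 <= x k) -> (n <= k)%N -> series x n <= series x k.
Proof. by move=> x0 nk; apply: nondecreasing_series => //. Qed.

(** A square of indices lies between two triangles: C_n <= X_n Y_n <= C_(2n) for the partial
    sums. *)
Lemma series_cauchy_ge0 x y :
  (forall k, 0 <= x k) -> (forall k, 0 <= y k) ->
  cvgn (series x) -> cvgn (series y) ->
  cvgn (series (cauchyM x y)) /\
  (series x n * series y n - series (cauchyM x y) n) @[n --> \oo] --> (0 : R).
Proof.
move=> x0 y0 cx cy.
have xyE n : series x n * series y n = \sum_(i < n) x i * series y n.
  by rewrite -mulr_suml /series/= big_mkord.
have C0 n : 0 <= cauchyM x y n by apply: sumr_ge0 => i _; exact: mulr_ge0.
have Cle n : series (cauchyM x y) n <= series x n * series y n.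
  rewrite series_cauchy xyE; apply: ler_sum => i _; rewrite ler_wpM2l//.
  by apply: series_le => //; exact: leq_subr.
have leC n : series x n * series y n <= series (cauchyM x y) n.*2.
  rewrite series_cauchy xyE -(big_mkord xpredT (fun i => x i * series y n)).
  rewrite -(big_mkord xpredT (fun i => x i * series y (n.*2 - i)%N)).
  rewrite [leRHS](@big_cat_nat _ _ _ n)//=; last by lia.
  rewrite ler_wpDr//; first by apply: sumr_ge0 => i _; rewrite mulr_ge0// series_ge0.
  apply: ler_sum_nat => i /andP[_ ni]; rewrite ler_wpM2l//.
  by apply: series_le => //; lia.
have cC : cvgn (series (cauchyM x y)).
  apply: nondecreasing_is_cvgn; first by apply: nondecreasing_series.
  exists (limn (series x) * limn (series y)) => _ [n _ <-].
  rewrite (le_trans (Cle n))// ler_pM ?series_ge0//.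
    by apply: nondecreasing_cvgn_le => //; exact: nondecreasing_series.
  by apply: nondecreasing_cvgn_le => //; exact: nondecreasing_series.
split=> //; rewrite -(subrr (limn (series (cauchyM x y)))).
apply: cvgB => //.
apply: (@squeeze_cvgr _ _ _ _ (series (cauchyM x y)) (fun n => series (cauchyM x y) n.*2)) => //.
  by apply: nearW => n; rewrite Cle leC.
apply: (cvg_comp (fun n => n.*2) (series (cauchyM x y)) _ cC).
move=> A [N _ NA]; exists N => //= n /= Nn; apply: NA => /=; lia.
Qed.

(** X_n Y_n - C_n is a sum over the same index pairs for the sequences and for their absolute
    values, so the nonnegative case bounds it. *)
Lemma cvg_series_cauchy x y :
  cvgn [normed series x] -> cvgn [normed series y] ->
  series (cauchyM x y) @ \oo --> limn (series x) * limn (series y).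
Proof.
move=> cx cy.
have [_ h] := series_cauchy_ge0 _ _ (fun k => normr_ge0 (x k)) (fun k => normr_ge0 (y k)) cx cy.
apply: cvg_sub0 (cvgM (normed_cvg cx) (normed_cvg cy)).
apply/cvgr0Pnorm_lt => e e0; have /cvgr0Pnorm_lt/(_ e e0) := h.
apply: filterS => n; apply: le_lt_trans.
rewrite (_ : (_ - _) n = series (cauchyM x y) n - series x n * series y n)//.
have E (a b : R^nat) : series a n * series b n - series (cauchyM a b) n =
    \sum_(i < n) a i * (series b n - series b (n - i)%N).
  rewrite series_cauchy [series a n]/series/= big_mkord mulr_suml -sumrB.
  by apply: eq_bigr => i _; rewrite mulrBr.
rewrite distrC !E (le_trans (ler_norm_sum _ _ _))// (le_trans _ (ler_norm _))//.
apply: ler_sum => i _; rewrite normrM ler_wpM2l//.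
by rewrite !sub_series_geq ?leq_subr//; exact: ler_norm_sum.
Qed.

Definition radius_ge1 (a : R^nat) := forall r : R, 0 <= r < 1 ->
  cvgn (series (fun n => `|a n| * r ^+ n)).

Lemma radius_ge1_normed (a : R^nat) (r : R) : radius_ge1 a -> 0 <= r < 1 ->
  cvgn [normed series (fun n => a n * r ^+ n)].
Proof.
move=> a1 /[dup] r01 /a1; rewrite /normed_series_of/=.
rewrite (_ : (fun n => `|a n| * r ^+ n) = (fun n => `|a n * r ^+ n|))//.
by apply/funext => n; rewrite normrM normrX [`|r|]ger0_norm//; case/andP: r01.
Qed.

Lemma radius_ge1_cvg (a : R^nat) (r : R) : radius_ge1 a -> 0 <= r < 1 ->
  cvgn (pseries a r).
Proof. by move=> a1 r01; apply: normed_cvg; exact: radius_ge1_normed. Qed.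

Lemma cauchy_pow (a b : R^nat) (r : R) n :
  cauchyM a b n * r ^+ n = cauchyM (fun k => a k * r ^+ k) (fun k => b k * r ^+ k) n.
Proof.
rewrite /cauchyM mulr_suml; apply: eq_bigr => i _.
by rewrite mulrACA -exprD subnKC// -ltnS.
Qed.

Lemma radius_ge1_cauchy (a b : R^nat) :
  radius_ge1 a -> radius_ge1 b -> radius_ge1 (cauchyM a b).
Proof.
move=> a1 b1 r r01; have r0 : 0 <= r by case/andP: r01.
have pow0 (c : R^nat) k : 0 <= `|c k| * r ^+ k by rewrite mulr_ge0 ?exprn_ge0.
have [+ _] := series_cauchy_ge0 _ _ (pow0 a) (pow0 b) (a1 _ r01) (b1 _ r01).
apply: series_le_cvg => n; first exact: pow0.
  by apply: sumr_ge0 => i _; rewrite mulr_ge0.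
by rewrite -cauchy_pow ler_wpM2r ?exprn_ge0// norm_cauchy_le.
Qed.

Lemma pseries_cauchy (a b : R^nat) (r : R) :
  radius_ge1 a -> radius_ge1 b -> 0 <= r < 1 ->
  limn (pseries (cauchyM a b) r) = limn (pseries a r) * limn (pseries b r).
Proof.
move=> a1 b1 r01; apply/cvg_lim => //.
rewrite /pseries (_ : (fun n => _) = cauchyM (fun k => a k * r ^+ k) (fun k => b k * r ^+ k)).
  by apply: cvg_series_cauchy; exact: radius_ge1_normed.
by apply/funext => n; rewrite cauchy_pow.
Qed.

(** Abel's lemma: a bound at some s between r and 1 gives a geometric majorant of ratio r / s. *)
Lemma radius_ge1_bounded (a : R^nat) :
  (forall r : R, 0 < r < 1 -> exists M, forall n, `|a n| * r ^+ n <= M) ->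
  radius_ge1 a.
Proof.
move=> aM r /andP[r0 r1]; pose s := (r + 1) / 2.
have [s0 s1 rs] : [/\ 0 < s, s < 1 & r < s] by rewrite /s; split; lra.
have [|M MP] := aM s; first by rewrite s0.
have M0 : 0 <= M by apply: le_trans (MP 0%N); rewrite mulr_ge0 ?exprn_ge0// ltW.
apply: (@series_le_cvg _ _ (geometric M (r / s))) => [n|n|n|].
- by rewrite mulr_ge0 ?exprn_ge0.
- by rewrite /geometric/= mulr_ge0// exprn_ge0// divr_ge0// ltW.
- rewrite /geometric/= expr_div_n mulrA ler_pdivlMr ?exprn_gt0// mulrAC ler_wpM2r ?exprn_ge0//; exact: MP.
- apply: is_cvg_geometric_series; rewrite ger0_norm; last by rewrite divr_ge0// ltW.
  by rewrite ltr_pdivrMr// mul1r.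
Qed.

Lemma radius_ge1_le (a b : R^nat) : (forall n, `|a n| <= `|b n|) ->
  radius_ge1 b -> radius_ge1 a.
Proof.
move=> ab b1 r r01; have /andP[r0 _] := r01.
by apply: series_le_cvg (b1 r r01) => n; rewrite ?mulr_ge0 ?exprn_ge0// ler_wpM2r ?exprn_ge0.
Qed.

End cauchy_product.

(** * The binomial series *)

Section binomial_series.
Context {R : realType}.
Implicit Types (c r : R) (n k : nat).

Lemma radius_ge1_binc c : radius_ge1 (binc c).
Proof.
apply: radius_ge1_bounded => r /andP[r0 r1].
pose z n := `|binc c n| * r ^+ n.
have z0 n : 0 <= z n by rewrite /z mulr_ge0 ?exprn_ge0// ltW.
(* From this N on, (|c| + n) r <= n + 1, so the terms decrease. *)
have [N NP] : exists N : nat, `|c| <= N%:R * (1 - r).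
  exists (Num.truncn (`|c| / (1 - r))).+1.
  rewrite -ler_pdivrMr ?subr_gt0//; apply/ltW.
  by rewrite truncnS_gt.
have zS n : (N <= n)%N -> z n.+1 <= z n.
  move=> Nn; rewrite -(ler_pM2l (ltr0Sn R n)).
  have -> : n.+1%:R * z n.+1 = (`|c + n%:R| * r) * z n.
    have := congr1 Num.norm (bincS c n); rewrite [LHS]normrM [RHS]normrM normr_nat => E.
    by rewrite /z mulrA E exprS; ring.
  rewrite ler_wpM2r//.
  have cn : `|c + n%:R| <= `|c| + n%:R by rewrite (le_trans (ler_normD _ _))// normr_nat.
  rewrite (le_trans (ler_wpM2r (ltW r0) cn))//.
  have Nn' : N%:R * (1 - r) <= n%:R * (1 - r) by rewrite ler_wpM2r ?ler_nat// subr_ge0 ltW.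
  rewrite -natr1; have c0 := normr_ge0 c; nra.
exists (\sum_(k < N.+1) z k) => n; rewrite -/(z n).
have zle n' : (n' <= N)%N -> z n' <= \sum_(k < N.+1) z k.
  move=> nN; rewrite (bigD1 (Ordinal (nN : (n' < N.+1)%N)))//= lerDl.
  exact: sumr_ge0.
have [/zle//|/ltnW Nn] := leqP n N.
rewrite -(subnKC Nn); elim: (n - N)%N => [|j IH]; first by rewrite addn0 zle.
by rewrite addnS (le_trans (zS _ _))// leq_addr.
Qed.

Lemma pseries_diffs_binc c : pseries_diffs (binc c) = (fun n => c * binc (c + 1) n).
Proof.
apply/funext => n; rewrite /pseries_diffs bincS /binc !mulrA; congr (_ / _).
elim: n => [|n IH]; first by rewrite !poch0 addr0.
by rewrite !pochS (mulrA c) -IH -natr1; ring.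
Qed.

Lemma is_cvg_pseries_scale c (a : R^nat) r : cvgn (pseries a r) ->
  cvgn (pseries (fun n => c * a n) r).
Proof.
move=> ca; rewrite /pseries (_ : (fun n => _) = (fun n => c *: (a n * r ^+ n))).
  exact: is_cvg_seriesZ.
by apply/funext => n; rewrite -mulrA.
Qed.

Lemma limn_pseries_scale c (a : R^nat) r : cvgn (pseries a r) ->
  limn (pseries (fun n => c * a n) r) = c * limn (pseries a r).
Proof.
move=> ca; rewrite /pseries (_ : (fun n => _) = (fun n => c *: (a n * r ^+ n))).
  exact: lim_seriesZ.
by apply/funext => n; rewrite -mulrA.
Qed.

(** Pascal's rule on the coefficients. *)
Lemma pseries_binc_onem c r : 0 <= r < 1 ->
  limn (pseries (binc c) r) = (1 - r) * limn (pseries (binc (c + 1)) r).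
Proof.
move=> r01; have cb := radius_ge1_cvg _ _ (radius_ge1_binc (c + 1)) r01.
apply/cvg_lim => //; rewrite -(cvg_shiftS (pseries (binc c) r)) mulrBl mul1r.
rewrite (_ : [sequence _]_n = (fun n => pseries (binc (c + 1)) r n.+1
   - r * pseries (binc (c + 1)) r n)).
  by apply: cvgB; [rewrite (cvg_shiftS (pseries _ r))|apply: cvgMr].
apply/funext => n /=; rewrite /pseries /series/=.
rewrite big_nat_recl//= [in RHS]big_nat_recl//= mulr_sumr -addrA -sumrB.
congr (_ + _); first by rewrite /binc !poch0.
apply: eq_bigr => i _; rewrite exprS.
have E : binc c i.+1 = binc (c + 1) i.+1 - binc (c + 1) i.
  have i0 : i.+1%:R != 0 :> R by rewrite pnatr_eq0.
  have /(congr1 (fun f => f i)) := pseries_diffs_binc c; rewrite /pseries_diffs => dE.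
  by apply: (mulfI i0); rewrite dE mulrBr bincS -natr1; ring.
by rewrite E; ring.
Qed.

Lemma limn_pseries0 (a : R^nat) : limn (pseries a 0) = a 0%N.
Proof.
apply/cvg_lim => //; rewrite -cvg_shiftS; apply: cvg_near_cst; apply: nearW => n.
rewrite /pseries /series/= big_nat_recl//= big1 => [|i _]; last by rewrite exprS mul0r mulr0.
by rewrite expr0 mulr1 addr0.
Qed.

(** By [pseries_diffs_binc] and [pseries_binc_onem], (1 - y)^c times the series has derivative 0;
    the mean value theorem carries its value 1 from 0 to r. *)
Lemma pseries_binc c r : 0 <= r < 1 ->
  limn (pseries (binc c) r) = (1 - r) `^ (- c).
Proof.
move=> /andP[]; rewrite le_eqVlt => /predU1P[<- _|r0 r1].
  by rewrite subr0 powR1 limn_pseries0 /binc poch0 fact0 invr1 mulr1.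
pose S c (y : R) : R := limn (pseries (binc c) y).
have dS (y : R) : `|y| < 1 -> is_derive y (1 : R) (S c) (c * S (c + 1) y).
  move=> y1; pose K := (`|y| + 1) / 2; have y0 := normr_ge0 y.
  have K01 : 0 <= K < 1 by rewrite /K; lra.
  have cK d := radius_ge1_cvg _ _ (radius_ge1_binc d) K01.
  have yK : `|y| < `|K| by rewrite [`|K|]ger0_norm /K; lra.
  have := @pseries_snd_diffs _ (binc c) K y (cK c).
  rewrite !pseries_diffs_binc (_ : pseries_diffs _ = fun n => (c * (c + 1)) * binc (c + 1 + 1) n).
    move=> /(_ (is_cvg_pseries_scale _ _ _ (cK _)) (is_cvg_pseries_scale _ _ _ (cK _)) yK).
    rewrite limn_pseries_scale//.
    exact: is_cvg_pseries_inside (cK _) yK.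
  apply/funext => n; rewrite -mulrA.
  have /(congr1 (fun f => f n)) := pseries_diffs_binc (c + 1).
  by rewrite /pseries_diffs => <-; ring.
pose F (y : R) : R := (1 - y) `^ c * S c y.
have dF (y : R) : -1 < y < 1 -> is_derive y (1 : R) F
    ((1 - y) `^ c * (c * S (c + 1) y) + S c y * (- (c * (1 - y) `^ (c - 1)))).
  move=> /andP[y0 y1].
  have dSy := dS y; rewrite ltr_norml y0 y1 in dSy; have {}dSy := dSy isT.
  have dp : is_derive y (1 : R) (fun y : R => (1 - y) `^ c) (- (c * (1 - y) `^ (c - 1))).
    have y1' : 0 < 1 - y by lra.
    have dB : is_derive y (1 : R) (fun z : R => 1 - z) (-1).
      by apply: is_derive_eq; rewrite add0r mul1r.
    have := @is_derive1_comp _ (@powR R ^~ c) (fun z : R => 1 - z) y _ _ (is_derive1_powR c y1') dB.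
    by rewrite mulrN1.
  exact: is_deriveM.
have : F r = F 0.
  apply/eqP; rewrite -subr_eq0; apply/eqP.
  have [] := @MVT_segment _ F (fun y : R => (1 - y) `^ c * (c * S (c + 1) y) + S c y * (- (c * (1 - y) `^ (c - 1)))) 0 r (ltW r0).
  - by move=> y; rewrite in_itv/= => /andP[? ?]; apply: dF; lra.
  - apply: continuous_in_subspaceT => y; rewrite inE/= in_itv/= => /andP[? ?].
    have y11 : -1 < y < 1 by lra.
    have d := dF y y11.
    exact/differentiable_continuous/derivable1_diffP.
  move=> y; rewrite in_itv/= => /andP[y0 yr] ->.
  have y01 : 0 <= y < 1 by rewrite y0 (le_lt_trans yr).
  rewrite /S (pseries_binc_onem c _ y01).
  have -> : (1 - y) `^ c = (1 - y) * (1 - y) `^ (c - 1).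
    have y1 : 0 < 1 - y by lra.
    by rewrite -[c in LHS](subrK 1) [LHS]powRD ?(gt_eqF y1) ?implybT// powRr1 ?ltW// mulrC.
  ring.
rewrite /F /S limn_pseries0 /binc poch0 fact0 invr1 mulr1 subr0 powR1 mulr1 => E.
have p0 : (1 - r) `^ c != 0 by rewrite gt_eqF// powR_gt0; lra.
by apply: (mulfI p0); rewrite E powRN mulfV.
Qed.

End binomial_series.

(** * Affine change of variables *)

Section affine_change_of_variables.
Context {R : realType}.
Local Notation mu := (@lebesgue_measure R).
Variables (c d : R) (c0 : 0 < c).

Let phi (x : R) : measurableTypeR R := c * x + d.

Let mphi : measurable_fun [set: measurableTypeR R] phi.
Proof. by apply: measurable_funD => //; exact: measurable_funM. Qed.

Let c0' : 0 <= c. Proof. exact: ltW. Qed.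

(** The image of Lebesgue measure under x -> c x + d, multiplied by c, agrees with Lebesgue measure
    on half-open intervals, which determine it. *)
Lemma ge0_integral_affine (f : R -> \bar R) :
  measurable_fun [set: R] f -> (forall x, 0 <= f x)%E ->
  (\int[mu]_x f x = c%:E * \int[mu]_x f (c * x + d)%R)%E.
Proof.
move=> mf f0.
have [nu nuE] : exists nu : {measure set (measurableTypeR R) -> \bar R},
    (nu : set (measurableTypeR R) -> \bar R) = pushforward mu phi.
  by unshelve refine (ex_intro _ _ (erefl (pushforward mu phi))).
rewrite (@eq_measure_integral _ _ _ _ (mscale (NngNum c0') nu)).
  rewrite ge0_integral_mscale//=; congr (_ * _)%E.
  by rewrite nuE ge0_integral_pushforward//= preimage_setT.
move=> A mA _; apply: lebesgue_measure_unique mA => X [[a b] _ <-] /=.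
rewrite /mscale/= nuE /pushforward lebesgue_measure_itv/=.
have -> : phi @^-1` `]a, b] = `](a - d) / c, (b - d) / c].
  apply/seteqP; split=> x /=; rewrite !in_itv/= /phi ltr_pdivrMr// ler_pdivlMr// [x * c]mulrC.
    by rewrite ltrBlDr lerBrDr.
  by rewrite ltrBlDr lerBrDr.
rewrite lebesgue_measure_itv/= !lte_fin ltr_pM2r ?invr_gt0// ltrD2r.
case: ifPn => _; last by rewrite mule0.
by rewrite -!EFinB -EFinM; congr EFin; field; rewrite gt_eqF.
Qed.

End affine_change_of_variables.

(** * Gamma and beta integrals in the extended reals *)

Section gamma_beta.
Context {R : realType}.
Local Notation mu := (@lebesgue_measure R).
Implicit Types (a b s t x : R).

(** The kernels are extended by 0, so that all integrals run over the whole line and substitutions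
    do not move the domain. *)
Definition gker a t : R := (0 < t)%R%:R * (t `^ (a - 1) * expR (- t)).
Definition bker a b s : R := (0 < s < 1)%R%:R * (s `^ (a - 1) * (1 - s) `^ (b - 1)).

Lemma gker_ge0 a t : 0 <= gker a t.
Proof. by rewrite /gker !mulr_ge0 ?powR_ge0 ?expR_ge0. Qed.

Lemma bker_ge0 a b s : 0 <= bker a b s.
Proof. by rewrite /bker !mulr_ge0 ?powR_ge0. Qed.

Lemma measurable_gt0 : measurable_fun [set: R] (fun t : R => (0 < t)%R%:R : R).
Proof.
rewrite (_ : (fun _ => _) = \1_(`]0, +oo[ : set R))//.
by apply/funext => t; rewrite indicE mem_setE in_itv/= andbT.
Qed.

Lemma measurable_gt0lt1 : measurable_fun [set: R] (fun t : R => (0 < t < 1)%R%:R : R).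
Proof.
rewrite (_ : (fun _ => _) = \1_(`]0, 1[ : set R))//.
by apply/funext => t; rewrite indicE mem_setE in_itv/=.
Qed.

Lemma measurable_gker a : measurable_fun [set: R] (gker a).
Proof.
apply: measurable_funM; first exact: measurable_gt0.
apply: measurable_funM; first exact: measurable_powR.
by apply: measurableT_comp => //.
Qed.

Lemma measurable_bker a b : measurable_fun [set: R] (bker a b).
Proof.
apply: measurable_funM; first exact: measurable_gt0lt1.
apply: measurable_funM; first exact: measurable_powR.
apply: (@measurableT_comp _ _ _ _ _ _ (@powR R ^~ (b - 1))); first exact: measurable_powR.
exact: measurable_funB.
Qed.

Definition GammaE a : \bar R := (\int[mu]_t (gker a t)%:E)%E.
Definition BetaE a b : \bar R := (\int[mu]_s (bker a b s)%:E)%E.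

Lemma GammaE_ge0 a : (0 <= GammaE a)%E.
Proof. by apply: integral_ge0 => t _; rewrite lee_fin gker_ge0. Qed.

Lemma BetaE_ge0 a b : (0 <= BetaE a b)%E.
Proof. by apply: integral_ge0 => t _; rewrite lee_fin bker_ge0. Qed.

Lemma gker_mul a b (r p : R) : 0 < r ->
  gker b (r * p) * gker a (r - r * p) = r^-1 * (gker (a + b) r * bker b a p).
Proof.
move=> r0; rewrite /gker /bker r0 pmulr_rgt0//.
have -> : (0 < r - r * p) = (p < 1) by rewrite subr_gt0 gtr_pMr.
have [p0|] := ltP 0 p; last by rewrite !mul0r !mulr0.
have [p1|] := ltP p 1; last by rewrite !mul0r !mulr0.
rewrite !mul1r (_ : r - r * p = r * (1 - p)); last by ring.
rewrite !powRM ?(ltW p0) ?(ltW r0)// ?subr_ge0 ?(ltW p1)//.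
have -> : r `^ (a + b - 1) = r * (r `^ (b - 1) * r `^ (a - 1)).
  rewrite -{2}(@powRr1 _ r) ?ltW// -!powRD ?(gt_eqF r0) ?implybT//.
  by congr (_ `^ _); ring.
have -> : expR (- r) = expR (- (r * p)) * expR (- (r * (1 - p))).
  by rewrite -expRD; congr expR; ring.
by field; rewrite gt_eqF.
Qed.

Lemma gker_convol a b r : (\int[mu]_t (gker b t * gker a (r - t))%:E =
  (gker (a + b) r)%:E * BetaE b a)%E.
Proof.
have [r0|r0] := ltP 0 r; last first.
  rewrite [gker (a + b) r]/gker ltNge r0 !mul0r mul0e integral0_eq// => t _.
  rewrite /gker; have [t0|] := ltP 0 t; last by rewrite !mul0r.
  by rewrite [0 < r - t]ltNge (_ : r - t <= 0) ?mul0r ?mulr0//; lra.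
have m1 : measurable_fun [set: R] (fun t => (gker b t * gker a (r - t))%:E).
  apply/measurable_EFinP; apply: measurable_funM; first exact: measurable_gker.
  apply: (@measurableT_comp _ _ _ _ _ _ (gker a)); first exact: measurable_gker.
  exact: measurable_funB.
rewrite (ge0_integral_affine r 0 r0)//; last first.
  by move=> x; rewrite lee_fin mulr_ge0 ?gker_ge0.
have -> : (\int[mu]_x (gker b (r * x + 0) * gker a (r - (r * x + 0)))%:E =
  \int[mu]_x ((r^-1 * gker (a + b) r)%:E * (bker b a x)%:E))%E.
  by apply: eq_integral => x _; rewrite addr0 gker_mul// -EFinM mulrA.
rewrite ge0_integralZl//.
- by rewrite muleA -EFinM mulVKf// gt_eqF.
- by apply/measurable_EFinP; exact: measurable_bker.
- by move=> x _; rewrite lee_fin bker_ge0.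
- by rewrite lee_fin mulr_ge0 ?gker_ge0 ?invr_ge0// ltW.
Qed.

(** Tonelli's theorem on the convolution of two gamma kernels; no finiteness is known yet. *)
Lemma GammaE_BetaE a b : (GammaE a * GammaE b = GammaE (a + b) * BetaE b a)%E.
Proof.
have mga := measurable_gker a; have mgb := measurable_gker b.
have gE (t : R) : GammaE a = (\int[mu]_r (gker a (r - t))%:E)%E.
  have mg : measurable_fun [set: R] (fun x => (gker a x)%:E) by exact/measurable_EFinP.
  have g0 (x : R) : (0 <= (gker a x)%:E)%E by rewrite lee_fin gker_ge0.
  rewrite /GammaE (ge0_integral_affine 1 (- t) ltr01 _ mg g0) mul1e.
  by apply: eq_integral => x _; rewrite mul1r.
pose h (z : R * R) : \bar R := (gker b z.1 * gker a (z.2 - z.1))%:E.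
have mh : measurable_fun setT h.
  apply/measurable_EFinP; apply: measurable_funM.
    by apply: (@measurableT_comp _ _ _ _ _ _ (gker b)).
  apply: (@measurableT_comp _ _ _ _ _ _ (gker a)) => //.
  exact: measurable_funB.
have h0 z : (0 <= h z)%E by rewrite lee_fin mulr_ge0 ?gker_ge0.
transitivity (\int[mu]_t \int[mu]_r h (t, r))%E.
  rewrite muleC -ge0_integralZr//.
  - apply: eq_integral => t _; rewrite {1}(gE t) -ge0_integralZl//.
    + by apply/measurable_EFinP/measurableT_comp => //; exact: measurable_funB.
    + by move=> x _; rewrite lee_fin gker_ge0.
    + by rewrite lee_fin gker_ge0.
  - exact/measurable_EFinP.
  - by move=> x _; rewrite lee_fin gker_ge0.
  - exact: GammaE_ge0.
etransitivity; first exact: (@fubini_tonelli _ _ _ _ R mu mu h mh h0).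
transitivity (\int[mu]_r ((gker (a + b) r)%:E * BetaE b a))%E.
  by apply: eq_integral => r _; rewrite -gker_convol.
rewrite ge0_integralZr//.
- by apply/measurable_EFinP; exact: measurable_gker.
- by move=> x _; rewrite lee_fin gker_ge0.
- exact: BetaE_ge0.
Qed.

Lemma integral_gt0E (f : R -> R) :
  (\int[mu]_(t in `]0%R, +oo[) (f t)%:E = \int[mu]_t ((0 < t)%R%:R * f t)%:E)%E.
Proof.
rewrite integral_mkcond; apply: eq_integral => t _; rewrite patchE mem_setE in_itv/= andbT.
by case: ltP => _; rewrite ?mul1r ?mul0r.
Qed.

Lemma integral_gt0lt1E (f : R -> R) :
  (\int[mu]_(t in `]0%R, 1%R[) (f t)%:E = \int[mu]_t ((0 < t < 1)%R%:R * f t)%:E)%E.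
Proof.
rewrite integral_mkcond; apply: eq_integral => t _; rewrite patchE mem_setE in_itv/=.
by case: ifP => _; rewrite ?mul1r ?mul0r.
Qed.

Lemma GammaE1 : GammaE 1 = 1%E.
Proof.
rewrite -(@integral_exponential_pdf R 1 ltr01).
rewrite [RHS](_ : _ = \int[mu]_(t in `]0%R, +oo[) (expR (- t))%:E)%E.
  by rewrite integral_gt0E; apply: eq_integral => t _; rewrite /gker subrr powRr0 mul1r.
rewrite integral_itv_obnd_cbnd; last first.
  by apply/measurable_EFinP/measurable_funTS; apply: measurableT_comp.
rewrite [RHS]integral_mkcond; apply: eq_integral => t _; rewrite /exponential_pdf !patchE.
by case: ifP => // _; rewrite mul1r mulN1r.
Qed.

Lemma BetaE1 a : 0 < a -> BetaE a 1 = (a^-1)%:E.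
Proof.
move=> a0.
transitivity (\int[mu]_(t in `]0%R, 1%R]) (t `^ (a - 1))%:E)%E.
  rewrite -integral_itv_bndo_bndc; last first.
    by apply/measurable_EFinP/measurable_funTS; exact: measurable_powR.
  rewrite integral_gt0lt1E; apply: eq_integral => t _.
  by rewrite /bker subrr powRr0 mulr1.
(* For a < 1 the integrand is unbounded at 0: the fundamental theorem is applied on [2^-(n+1), 1],
   then monotone convergence. *)
pose e n : R := 2^-1 ^+ n.+1.
have e0 n : 0 < e n by rewrite exprn_gt0// invr_gt0.
have e1 n : e n < 1 by rewrite exprn_ilt1// ?invr_ge0// invf_lt1// ltr1n.
pose F n : set (measurableTypeR R) := `[e n, 1%R].
have UF : `]0%R, 1%R] = \bigcup_n F n.
  apply/seteqP; split=> x /=; last first.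
    by move=> [n _]; rewrite /F /= !in_itv/= => /andP[ex x1]; rewrite x1 (lt_le_trans (e0 n)).
  rewrite in_itv/= => /andP[x0 x1].
  exists (Num.truncn x^-1) => //; rewrite /F/= in_itv/= x1 andbT /e exprVn.
  rewrite -[leRHS]invrK lef_pV2 ?posrE ?invr_gt0 ?exprn_gt0// ltW//.
  by rewrite (lt_trans (truncnS_gt _))// -natrX ltr_nat ltn_expl.
have mpow : measurable_fun [set: measurableTypeR R] (fun t : R => (t `^ (a - 1))%:E).
  by apply/measurable_EFinP; exact: measurable_powR.
have FE n : (\int[mu]_(t in F n) (t `^ (a - 1))%:E = (a^-1 - a^-1 * (2^-1 `^ a) ^+ n.+1)%:E)%E.
  have dP (x : R) : 0 < x ->
      is_derive x (1 : R) (fun t : R => a^-1 * t `^ a) (x `^ (a - 1)).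
    move=> x0; have d := is_derive1_powR a x0.
    by apply: is_derive_eq; rewrite /GRing.scale/= mulKf// gt_eqF.
  have cont (b x : R) : 0 < x -> {for x, continuous (fun t : R => t `^ b)}.
    move=> x0; have d := is_derive1_powR b x0.
    exact/differentiable_continuous/derivable1_diffP.
  have contF (x : R) : 0 < x -> {for x, continuous (fun t : R => a^-1 * t `^ a)}.
    move=> x0; have d := dP _ x0.
    exact/differentiable_continuous/derivable1_diffP.
  rewrite (@continuous_FTC2 _ _ (fun t : R => a^-1 * t `^ a) _ _ (e1 n)).
  - have h0 : 0 <= 2^-1 :> R by rewrite invr_ge0.
    by rewrite powR1 mulr1 -EFinB /e -(powR_mulrn n.+1 h0) powRAC powR_mulrn ?powR_ge0.
  - apply: continuous_in_subspaceT => x; rewrite inE/= in_itv/= => /andP[ex _].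
    by apply: cont; rewrite (lt_le_trans (e0 n)).
  - split.
    + move=> x; rewrite in_itv/= => /andP[ex _].
      by have d := dP x (lt_trans (e0 n) ex).
    + by apply: cvg_at_right_filter; exact: contF.
    + by apply: cvg_at_left_filter; exact: contF.
  - move=> x; rewrite in_itv/= => /andP[ex _].
    by have d := dP x (lt_trans (e0 n) ex); rewrite derive1E derive_val.
rewrite UF.
have cF : (\int[mu]_(t in F n) (t `^ (a - 1))%:E)%E @[n --> \oo] -->
    (\int[mu]_(t in \bigcup_n F n) (t `^ (a - 1))%:E)%E.
  apply: ge0_nondecreasing_set_cvg_integral.
  - apply/nondecreasing_seqP => n; rewrite subsetEset => x; rewrite /F/= !in_itv/=.
    move=> /andP[ex ->]; rewrite andbT (le_trans _ ex)// /e [leLHS]exprS.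
    by rewrite ger_pMl ?exprn_gt0 ?invr_gt0// invf_le1// ler1n.
  - by move=> n; exact: measurable_itv.
  - by move=> n; exact: measurable_funTS.
  - by move=> n x _; rewrite lee_fin powR_ge0.
rewrite (funext FE) in cF; apply: (cvg_unique _ cF) => //.
apply: cvg_EFin; first exact: nearW.
rewrite [X in _ --> X](_ : a^-1 = a^-1 - a^-1 * 0); last by rewrite mulr0 subr0.
apply: cvgB; first exact: cvg_cst.
apply: cvgM; first exact: cvg_cst.
rewrite (cvg_shiftS (fun n => (2^-1 `^ a) ^+ n)); apply: cvg_expr.
rewrite ger0_norm ?powR_ge0//.
have := @gt0_ltr_powR R a a0 2^-1 1; rewrite powR1; apply; rewrite ?nnegrE ?invr_ge0//.
by rewrite invf_lt1// ltr1n.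
Qed.

End gamma_beta.

(** * Finite Gamma and beta functions; power series against a beta kernel *)

Section gamma_function.
Context {R : realType}.
Local Notation mu := (@lebesgue_measure R).
Implicit Types (a b s t x : R).

(** The beta identity with one parameter equal to 1 replaces integration by parts. *)
Lemma GammaES a : 0 < a -> (GammaE a = GammaE (a + 1) * (a^-1)%:E)%E.
Proof.
by move=> a0; rewrite -BetaE1// [a + 1]addrC -GammaE_BetaE GammaE1 mul1e.
Qed.

Lemma GammaE_nat n : (GammaE (n.+1%:R : R) < +oo)%E.
Proof.
elim: n => [|n IH]; first by rewrite GammaE1 ltry.
have n0 : 0 < n.+1%:R :> R by rewrite ltr0n.
move: IH; rewrite (GammaES _ n0) natr1.
case: (GammaE _) (GammaE_ge0 (n.+2%:R : R)) => [r _ _|_|//]; first exact: ltry.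
by rewrite gt0_mulye ?lte_fin ?invr_gt0.
Qed.

(** The functional equation reduces to a >= 1, where t^(a-1) <= 1 + t^n for an integer n > a - 1. *)
Lemma GammaE_lty a : 0 < a -> (GammaE a < +oo)%E.
Proof.
wlog a1 : a / 1 <= a => [hw a0|_].
  have : (GammaE (a + 1) < +oo)%E by apply: hw; lra.
  rewrite (GammaES _ a0); case: (GammaE _) (GammaE_ge0 (a + 1)) => [r _ _|//|//].
  exact: ltry.
pose n := Num.truncn a; have an : a < n.+1%:R by exact: truncnS_gt.
have mg b : measurable_fun [set: measurableTypeR R] (fun t => (gker b t)%:E).
  by apply/measurable_EFinP; exact: measurable_gker.
have g0 b (t : R) : (0 <= (gker b t)%:E)%E by rewrite lee_fin gker_ge0.
apply: (@le_lt_trans _ _ (GammaE 1 + GammaE n.+1%:R)%E); last first.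
  by apply: lte_add_pinfty; [rewrite GammaE1 ltry|exact: GammaE_nat].
rewrite /GammaE -ge0_integralD//; apply: ge0_le_integral => //.
  exact: emeasurable_funD.
move=> t _; rewrite -EFinD lee_fin /gker.
have [t0|] := ltP 0 t; last by rewrite !mul0r addr0.
rewrite !mul1r -mulrDl ler_wpM2r ?expR_ge0//.
have [t1|t1] := leP t 1.
  rewrite (le_trans (_ : _ <= t `^ (1 - 1)))//; last by rewrite lerDl powR_ge0.
  by apply: ger_powR; [rewrite t0|lra].
rewrite (le_trans (_ : _ <= t `^ (n.+1%:R - 1)))//; last by rewrite lerDr powR_ge0.
by apply: ler_powR; [exact: ltW|lra].
Qed.

Lemma GammaEE a : 0 < a -> GammaE a = (Gamma a)%:E.
Proof.
move=> a0; rewrite /Gamma /Rintegral integral_gt0E fineK//.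
by rewrite ge0_fin_numE ?GammaE_ge0// GammaE_lty.
Qed.

Lemma Gamma_gt0 a : 0 < a -> 0 < Gamma a.
Proof.
move=> a0; rewrite -lte_fin -GammaEE//.
(* On [1, 2] the integrand is at least exp(-2) / 2, as t^(a-1) >= 1 / t. *)
apply: (@lt_le_trans _ _ (\int[mu]_(t in `[1%R, 2%R]) (expR (- 2) / 2)%:E)%E).
  rewrite integral_cst//= lebesgue_measure_itv/= lte_fin ltr1n -EFinB -EFinM lte_fin.
  by rewrite mulr_gt0 ?divr_gt0 ?expR_gt0//; lra.
apply: (@le_trans _ _ (\int[mu]_(t in `[1%R, 2%R]) (gker a t)%:E)%E); last first.
  apply: ge0_subset_integral => //.
  - by apply/measurable_EFinP; exact: measurable_gker.
  - by move=> t _; rewrite lee_fin gker_ge0.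
apply: ge0_le_integral => //.
- by apply/measurable_EFinP/measurable_funTS; exact: measurable_gker.
move=> t /=; rewrite in_itv/= => /andP[t1 t2]; have t0 : 0 < t by lra.
rewrite lee_fin /gker t0 mul1r mulrC ler_pM ?expR_ge0//; last by rewrite ler_expR; lra.
apply: (@le_trans _ _ (t `^ (-1))); last by apply: ler_powR; lra.
by rewrite powR_inv1 ?(ltW t0)// lef_pV2 ?posrE.
Qed.

Lemma GammaS a : 0 < a -> Gamma (a + 1) = a * Gamma a.
Proof.
move=> a0; have := GammaES _ a0; rewrite !GammaEE//; last by lra.
by rewrite -EFinM => -[->]; rewrite mulrCA mulfV ?mulr1// gt_eqF.
Qed.

Lemma Gamma_poch a n : 0 < a -> Gamma (a + n%:R) = poch a n * Gamma a.
Proof.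
move=> a0; elim: n => [|n IH]; first by rewrite addr0 poch0 mul1r.
by rewrite -natr1 addrA GammaS ?IH ?pochS; [ring|rewrite ltr_wpDr].
Qed.

Definition Beta a b := Gamma a * Gamma b / Gamma (a + b).

Lemma Beta_gt0 a b : 0 < a -> 0 < b -> 0 < Beta a b.
Proof. by move=> a0 b0; rewrite divr_gt0 ?mulr_gt0 ?Gamma_gt0 ?addr_gt0. Qed.

(** An infinite beta integral would make Gamma(a) Gamma(b) infinite. *)
Lemma BetaEE a b : 0 < a -> 0 < b -> BetaE a b = (Beta a b)%:E.
Proof.
move=> a0 b0; have ab0 := addr_gt0 a0 b0.
have := GammaE_BetaE b a; rewrite [b + a]addrC (GammaEE _ a0) (GammaEE _ b0) (GammaEE _ ab0).
rewrite /Beta; move: (Gamma_gt0 _ ab0) (Gamma a) (Gamma b) => + A B.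
move: (Gamma (a + b)) => C C0.
case: (BetaE a b) (BetaE_ge0 a b) => [r _|_|//]; last first.
  by rewrite gt0_muley ?lte_fin.
by rewrite -!EFinM => -[E]; congr EFin; rewrite [A * B]mulrC E mulrAC mulfV ?mul1r// gt_eqF.
Qed.

Lemma Beta_poch_l a b n : 0 < a -> 0 < b ->
  Beta (a + n%:R) b = Beta a b * (poch a n / poch (a + b) n).
Proof.
move=> a0 b0; rewrite /Beta addrAC !Gamma_poch ?addr_gt0//.
have /lt0r_neq0 := poch_gt0 (a + b) n (addr_gt0 a0 b0).
have /lt0r_neq0 := Gamma_gt0 _ (addr_gt0 a0 b0).
move: (Gamma (a + b)) (poch (a + b) n) (Gamma a) (Gamma b) => x y z w x0 y0.
by field; rewrite x0 y0.
Qed.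

Lemma Beta_poch_r a b n : 0 < a -> 0 < b ->
  Beta a (b + n%:R) = Beta a b * (poch b n / poch (a + b) n).
Proof.
move=> a0 b0; rewrite /Beta addrA !Gamma_poch ?addr_gt0//.
have /lt0r_neq0 := poch_gt0 (a + b) n (addr_gt0 a0 b0).
have /lt0r_neq0 := Gamma_gt0 _ (addr_gt0 a0 b0).
move: (Gamma (a + b)) (poch (a + b) n) (Gamma a) (Gamma b) => x y z w x0 y0.
by field; rewrite x0 y0.
Qed.

Lemma bker_mull a b s n : s ^+ n * bker a b s = bker (a + n%:R) b s.
Proof.
rewrite /bker; have [/andP[s0 s1]|_] := boolP (0 < s < 1); last by rewrite !mul0r mulr0.
rewrite !mul1r mulrA -powR_mulrn ?ltW// -powRD ?(gt_eqF s0) ?implybT//.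
by congr (_ `^ _ * _); ring.
Qed.

Lemma bker_mulr a b s n : bker a b s * (1 - s) ^+ n = bker a (b + n%:R) s.
Proof.
rewrite /bker; have [/andP[s0 s1]|_] := boolP (0 < s < 1); last by rewrite !mul0r.
have s1' : 0 < 1 - s by lra.
rewrite !mul1r -mulrA -powR_mulrn ?ltW// -powRD ?(gt_eqF s1') ?implybT//.
by congr (_ * _ `^ _); ring.
Qed.

Lemma integrable_bker a b : 0 < a -> 0 < b ->
  mu.-integrable [set: measurableTypeR R] (fun s => (bker a b s)%:E).
Proof.
move=> a0 b0; apply/integrableP; split.
  by apply/measurable_EFinP; exact: measurable_bker.
under eq_integral do rewrite gee0_abs ?lee_fin ?bker_ge0//.
by rewrite -/(BetaE a b) BetaEE// ltry.
Qed.

(** The ratio (q)_j / (p + q)_j is the mean of (1 - s)^j under the beta law of parameters p and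
    q. *)
Definition beta_ratio p q (c : R^nat) : R^nat :=
  fun j => c j * (poch q j / poch (p + q) j).

Lemma radius_ge1_beta_ratio p q c : 0 < p -> 0 < q ->
  radius_ge1 c -> radius_ge1 (beta_ratio p q c).
Proof.
move=> p0 q0; apply: radius_ge1_le => n; rewrite /beta_ratio normrM ler_piMr//.
have pq := poch_gt0 (p + q) n (addr_gt0 p0 q0); have qn := poch_gt0 q n q0.
rewrite ger0_norm; last by rewrite divr_ge0 ?ltW.
rewrite ler_pdivrMr// mul1r ler_prod// => i _.
by rewrite addr_ge0 ?(ltW q0)//=; lra.
Qed.

(** Termwise integration by dominated convergence; the bound is the beta kernel times the sum of the
    |c_n| y^n. *)
Lemma integral_bker_pseries p q y (c : R^nat) : 0 < p -> 0 < q ->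
  0 <= y < 1 -> radius_ge1 c ->
  mu.-integrable [set: measurableTypeR R]
    (fun s => (bker p q s * limn (pseries c (y * (1 - s))))%:E) /\
  (\int[mu]_s (bker p q s * limn (pseries c (y * (1 - s))))%:E =
  (Beta p q * limn (pseries (beta_ratio p q c) y))%:E)%E.
Proof.
move=> p0 q0 y01 c1; have /andP[y0 y1] := y01.
pose f_ n s := (bker p q s * pseries c (y * (1 - s)) n)%:E.
have f_P n : mu.-integrable [set: measurableTypeR R] (f_ n) /\
    (\int[mu]_s f_ n s = (Beta p q * pseries (beta_ratio p q c) y n)%:E)%E.
  elim: n => [|n [intn IH]].
    have -> : f_ 0%N = cst 0%E.
      by apply/funext => s; rewrite /f_ /pseries /series/= big_nil mulr0.
    split; first exact: integrable0.
    by rewrite integral0 /pseries /series/= big_nil mulr0.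
  have E : f_ n.+1 = (f_ n \+ (fun s => (c n * y ^+ n)%:E * (bker p (q + n%:R) s)%:E))%E.
    apply/funext => s; rewrite /f_ -EFinM -EFinD /pseries seriesSr mulrDr; congr (_ + _)%:E.
    by rewrite -bker_mulr/= exprMn; ring.
  have qn0 : 0 < q + n%:R by rewrite ltr_wpDr.
  have intb := integrable_bker _ _ p0 qn0.
  have intc : mu.-integrable [set: measurableTypeR R]
      (fun s => (c n * y ^+ n)%:E * (bker p (q + n%:R) s)%:E)%E by exact: integrableZl.
  rewrite E; split; first exact: integrableD.
  rewrite integralD// IH integralZl// -/(BetaE _ _) BetaEE// Beta_poch_r//.
  by rewrite -EFinM -EFinD /pseries seriesSr /beta_ratio; congr EFin; rewrite /=; ring.
pose M := limn (series (fun n => `|c n| * y ^+ n)).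
have cM := c1 y y01.
have ys (s : R) : 0 < s < 1 -> 0 <= y * (1 - s) < 1 /\ y * (1 - s) <= y.
  move=> /andP[s0 s1]; have ysy : y * (1 - s) <= y by nra.
  by rewrite ysy (le_lt_trans ysy)// mulr_ge0// subr_ge0 ltW.
have f_f (s : R) : f_ n s @[n --> \oo] --> (bker p q s * limn (pseries c (y * (1 - s))))%:E.
  have [/ys[s01 _]|s01] := boolP (0 < s < 1).
    apply: cvg_EFin; first exact: nearW.
    by apply: cvgM; [exact: cvg_cst|exact: radius_ge1_cvg].
  have b0 : bker p q s = 0 by rewrite /bker (negPf s01) mul0r.
  rewrite b0 mul0r (_ : (fun n => f_ n s) = cst 0%E); first exact: cvg_cst.
  by apply/funext => n; rewrite /f_ b0 mul0r.
have mf_ n : measurable_fun [set: measurableTypeR R] (f_ n).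
  by have [/integrableP[]] := f_P n.
have [||||int1 _ lim1] := @dominated_convergence _ _ _ mu setT measurableT f_
  (fun s => (bker p q s * limn (pseries c (y * (1 - s))))%:E)
  (fun s => (bker p q s)%:E * M%:E)%E mf_.
- by apply: (emeasurable_fun_cvg f_) => // s _; exact: f_f.
- by apply: aeW => s _; exact: f_f.
- by apply: integrableZr => //; exact: integrable_bker.
- apply: aeW => s n _; rewrite -EFinM abse_EFin lee_fin normrM [`|bker _ _ _|]ger0_norm ?bker_ge0//.
  have [/ys[/andP[s0 _] sy]|s01] := boolP (0 < s < 1); last first.
    by rewrite /bker (negPf s01) !mul0r.
  rewrite ler_wpM2l ?bker_ge0// (le_trans (ler_norm_sum _ _ _))//.
  apply: (@le_trans _ _ (series (fun n => `|c n| * y ^+ n) n)).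
    apply: ler_sum => i _; rewrite normrM ler_wpM2l// normrX lerXn2r ?nnegrE//.
    by rewrite ger0_norm.
  apply: nondecreasing_cvgn_le => //; apply: nondecreasing_series => i _ _.
  by rewrite mulr_ge0 ?exprn_ge0.
split => //; apply: cvg_unique lim1 _ => //.
rewrite (_ : [sequence _]_n = EFin \o (fun n => Beta p q * pseries (beta_ratio p q c) y n)).
  apply: cvg_EFin; first exact: nearW.
  apply: cvgM; first exact: cvg_cst.
  apply: radius_ge1_cvg => //; exact: radius_ge1_beta_ratio.
by apply/funext => n /=; have [_ ->] := f_P n.
Qed.

End gamma_function.

(** * The beta step on normalized sequences *)

Section hat_operators.
Context {R : realType}.
Implicit Types (g al d : R) (c : nat -> R).

Lemma hat_lt0 g c (n : int) : n < 0 -> hat g c n = 0.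
Proof. by case: n. Qed.

Lemma mulXpow_hat g al c :
  mulXpow g al 0 (hat g c) (hat g (cauchyM (binc (- al)) c)).
Proof.
split=> [n n0|n K nK]; first by apply: hat_lt0; lia.
under eq_bigr do rewrite iter_mulYE.
case: n nK => n nK; last first.
  by rewrite big1// => k _; rewrite hat_lt0 ?mulr0//; lia.
rewrite -(big_mkord xpredT (fun k => binc (- al) k *
  ((\prod_(j < k) (n%:~R + g - 1 - j%:R)) * hat g c (n%:Z - k%:Z)))).
rewrite (@big_cat_nat _ _ _ n.+1)//=; last by lia.
rewrite [X in _ + X]big_nat_cond [X in _ + X]big1 ?addr0; last first.
  by move=> k kn; rewrite hat_lt0 ?mulr0//; lia.
rewrite big_mkord /cauchyM mulr_sumr; apply: eq_bigr => k _.
have kn : (k <= n)%N by rewrite -ltnS.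
by rewrite subzn//= (poch_sub _ _ _ kn); ring.
Qed.

(** The normalization absorbs the ratios: the fractional integral leaves the sequence unchanged. *)
Lemma hat_beta_ratio g d c : 0 < g -> 0 < d ->
  hat (g + d) (beta_ratio d g c) = hat g c.
Proof.
move=> g0 d0; apply/funext => -[n|//] /=; rewrite /beta_ratio [d + g]addrC.
have := poch_gt0 (g + d) n (addr_gt0 g0 d0); move: (poch (g + d) n) => x x0.
by field; rewrite gt_eqF.
Qed.

(** The empty product of beta variables is the constant 1, whose law is the point mass at y = 0,
    that is, the sequence [e] with g = 0. One beta step from it gives the beta density. *)
Lemma hypergeom_eq_binc u v :
  hypergeom_eq (v - u) [:: u - 1] [:: v - 2] (hat (v - u) (binc (1 - u) : nat -> R)).
Proof.
pose e (k : nat) : R := (k == 0%N)%:R.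
have hat0 g c : c 0%N = 1 -> (g = 0) \/ (c = e) -> hat g c = hat 0 e.
  move=> c0 ge; apply/funext => -[[|k]|k] //=; first by rewrite !poch0 c0.
  rewrite /e mulr0; case: ge => [->|->]; last by rewrite mulr0.
  by rewrite /poch big_ord_recl/= addr0 !mul0r.
have cauchye c : cauchyM c e = c.
  apply/funext => n; rewrite /cauchyM big_ord_recr/= subnn mulr1 big1 ?add0r// => i _.
  by rewrite /e subn_eq0 leqNgt ltn_ord mulr0.
(* The equation f = x f for the point mass: y f = 0. *)
have h0 : hypergeom_eq 0 [::] [::] (hat 0 e).
  move=> n; rewrite /mulX /mulY /=.
  have [->|n1] := eqVneq n 1; first by rewrite addr0 subrr mul0r subr0.
  suff -> : hat 0 e (n - 1) = 0 by rewrite mulr0 subr0.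
  by case E : (n - 1) => [[|k]|k] //=; [lia|rewrite /e mulr0].
have s1 := mulXpow_hat 0 (1 - v) e.
rewrite (hat0 0 (cauchyM _ e)) in s1; last 2 first.
  by rewrite cauchye /binc poch0 fact0 invr1 mulr1.
  by left.
have s2 := mulXpow_hat (v - u) (u - 1) e.
rewrite cauchye opprB (hat0 (v - u) e) in s2; last 2 first.
  by [].
  by right.
rewrite -[v - u]add0r in s2.
have := hypergeom_eq_beta _ _ _ _ _ _ _ _ _ _ s1 s2 h0.
by rewrite add0r.
Qed.

Lemma hypergeom_eq_step g w z P Q a : 0 < g -> w < z ->
  hypergeom_eq g P Q (hat g a) ->
  hypergeom_eq (g + (z - w)) (w - 1 :: P) (z - 2 :: Q)
    (hat (g + (z - w)) (cauchyM (binc (1 - w))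
       (beta_ratio (z - w) g (cauchyM (binc (z - 1)) a)))).
Proof.
move=> g0 wz; have d0 : 0 < z - w by lra.
have := mulXpow_hat g (1 - z) a; rewrite opprB => s1.
have := mulXpow_hat (g + (z - w)) (w - 1)
  (beta_ratio (z - w) g (cauchyM (binc (z - 1)) a)).
rewrite hat_beta_ratio// opprB => s2.
exact: hypergeom_eq_beta s1 s2.
Qed.

End hat_operators.

(** * Densities of products of independent beta variables *)

Section density.
Context {R : realType}.
Local Notation mu := (@lebesgue_measure R).
Implicit Types (ps : seq (R * R)) (a : R^nat) (F : R -> R) (x t s w z : R).

Definition sdelta ps : R := \sum_(p <- ps) (p.2 - p.1).
Definition nconst ps : R :=
  (Gamma (sdelta ps))^-1 * \prod_(p <- ps) (Gamma p.2 / Gamma p.1).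

(** The invariant of the induction on the number of factors. [F] is 0 at both endpoints; its value
    at 1 is corrected at the very end. *)
Record beta_product_density ps a F : Prop := BetaProductDensity {
  bpd_coef0 : a 0%N = 1;
  bpd_radius : radius_ge1 a;
  bpd_measurable : measurable_fun [set: R] F;
  bpd_ge0 : forall x, 0 <= F x;
  bpd_out : forall x, ~~ (0 < x < 1) -> F x = 0;
  bpd_series : forall x, 0 < x < 1 ->
    F x = nconst ps * (1 - x) `^ (sdelta ps - 1) * limn (pseries a (1 - x));
  bpd_moment : forall n, (\int[mu]_x (x ^+ n * F x)%:E =
    (\prod_(p <- ps) (poch p.1 n / poch p.2 n))%:E)%E;
  bpd_eq : hypergeom_eq (sdelta ps) [seq p.1 - 1 | p <- ps] [seq p.2 - 2 | p <- ps]
    (hat (sdelta ps) a) }.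

Lemma pseries_binc_pow (e x : R) : 0 < x < 1 ->
  limn (pseries (binc e) (1 - x)) = x `^ (- e).
Proof.
by move=> /andP[x0 x1]; rewrite pseries_binc; [rewrite subKr|lra].
Qed.

Lemma beta_density w z : 0 < w -> w < z -> beta_product_density [:: (w, z)]
  (binc (1 - w)) (fun x => (Beta w (z - w))^-1 * bker w (z - w) x).
Proof.
move=> w0 wz; have d0 : 0 < z - w by lra.
have z0 := lt_trans w0 wz.
have B0 := Beta_gt0 _ _ w0 d0.
have Bi0 : 0 <= (Beta w (z - w))^-1 by rewrite invr_ge0 ltW.
have sE : sdelta [:: (w, z)] = z - w by rewrite /sdelta big_seq1.
split.
- by rewrite /binc poch0 fact0 invr1 mulr1.
- exact: radius_ge1_binc.
- by apply: measurable_funM => //; exact: measurable_bker.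
- by move=> x; rewrite mulr_ge0 ?bker_ge0.
- by move=> x x01; rewrite /bker (negPf x01) mul0r mulr0.
- move=> x x01; rewrite pseries_binc_pow// opprB sE /nconst sE big_seq1 /bker x01 mul1r.
  rewrite /Beta (_ : w + (z - w) = z); last by ring.
  have alg (A B C D E : R) : A * B * C * (D * E) = B * (C * A) * E * D by ring.
  rewrite !invfM invrK; exact: (alg (Gamma w)^-1 (Gamma (z - w))^-1 (Gamma z)).
- move=> n; rewrite big_seq1/=.
  have -> : (\int[mu]_x (x ^+ n * ((Beta w (z - w))^-1 * bker w (z - w) x))%:E =
      \int[mu]_x (((Beta w (z - w))^-1)%:E * (bker (w + n%:R) (z - w) x)%:E))%E.
    by apply: eq_integral => x _; rewrite mulrCA bker_mull EFinM.
  rewrite ge0_integralZl//.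
  + rewrite -/(BetaE _ _) BetaEE//; last by rewrite ltr_wpDr.
    rewrite -EFinM Beta_poch_l// (_ : w + (z - w) = z); last by ring.
    by rewrite mulKf// gt_eqF.
  + by apply/measurable_EFinP; exact: measurable_bker.
  + by move=> x _; rewrite lee_fin bker_ge0.
- by rewrite sE; exact: hypergeom_eq_binc.
Qed.

(** * One more beta factor: the Mellin convolution *)

Section step.
Variables (ps : seq (R * R)) (a : R^nat) (F : R -> R) (w z : R).
Hypotheses (w0 : 0 < w) (wz : w < z) (g0 : 0 < sdelta ps).
Hypothesis aF : beta_product_density ps a F.

Let d := z - w.
Let g := sdelta ps.
Let C := (Beta w d)^-1.
(** Coefficients of x^(1-z) F, up to a constant and a power of y; [b] then applies the fractional
    integral of order d and the factor x^(w-1). *)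
Let c := cauchyM (binc (z - 1)) a.
Let b := cauchyM (binc (1 - w)) (beta_ratio d g c).
Let d0 : 0 < d. Proof. by rewrite subr_gt0. Qed.
Let C0 : 0 < C. Proof. by rewrite invr_gt0 Beta_gt0. Qed.
Let c1 : radius_ge1 c.
Proof. by apply: radius_ge1_cauchy; [exact: radius_ge1_binc|exact: bpd_radius aF]. Qed.

(* the joint density of (X B, X), where X has density F and B is an independent
   beta variable of parameters w and z - w *)
Let h (q : R * R) : R := F q.2 * (q.2 `^ (-1) * (C * bker w d (q.1 * q.2 `^ (-1)))).

Let h_ge0 q : 0 <= h q.
Proof. by rewrite /h mulr_ge0 ?(bpd_ge0 _ _ _ aF)// mulr_ge0 ?powR_ge0// mulr_ge0 ?bker_ge0// ltW. Qed.

Let mh : measurable_fun [set: R * R] h.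
Proof.
have mp : measurable_fun [set: R * R] (fun q : R * R => q.2 `^ (-1)).
  apply: (@measurableT_comp _ _ _ _ _ _ (@powR R ^~ (-1))); first exact: measurable_powR.
  exact: measurable_snd.
apply: measurable_funM.
  apply: (@measurableT_comp _ _ _ _ _ _ F); first exact: bpd_measurable aF.
  exact: measurable_snd.
apply: measurable_funM => //; apply: measurable_funM => //.
apply: (@measurableT_comp _ _ _ _ _ _ (bker w d)); first exact: measurable_bker.
by apply: measurable_funM => //; exact: measurable_fst.
Qed.

Let h_out x t : ~~ (0 < x < 1) -> h (x, t) = 0.
Proof.
move=> x01; rewrite /h/=; have [/andP[t0 t1]|t01] := boolP (0 < t < 1); last first.
  by rewrite (bpd_out _ _ _ aF)// mul0r.
rewrite /bker powR_inv1 ?ltW// pmulr_lgt0 ?invr_gt0// ltr_pdivrMr// mul1r.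
rewrite (_ : _ && _ = false) ?mul0r ?mulr0//.
by apply: contraNF x01 => /andP[-> xt]; rewrite (lt_trans xt).
Qed.

(** With t = x + (1 - x) s, 1 - t = (1 - x)(1 - s) and 1 - x / t = (1 - x) s / t. The powers of t
    collect to t^(1-z), which the series [c] absorbs. *)
Let hE x s : 0 < x < 1 -> h (x, (1 - x) * s + x) =
  C * nconst ps * x `^ (w - 1) * (1 - x) `^ (g + d - 2) *
  (bker d g s * limn (pseries c ((1 - x) * (1 - s)))).
Proof.
move=> /andP[x0 x1]; rewrite /h/=; set t := _ * s + x.
have y0 : 0 < 1 - x by lra.
have [/andP[s0 s1]|s01] := boolP (0 < s < 1); last first.
  rewrite [bker d g s]/bker (negPf s01) !mul0r mulr0.
  have [t01|t01] := boolP (0 < t < 1); last by rewrite (bpd_out _ _ _ aF)// mul0r.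
  move/andP: t01 => [t0 t1].
  rewrite /bker powR_inv1 ?ltW// ltr_pdivrMr// mul1r.
  rewrite (_ : _ && _ = false) ?mul0r ?mulr0//; apply: contraNF s01 => /andP[_].
  by rewrite /t ltrDr pmulr_rgt0// => ->/=; move: t1; rewrite /t; nra.
have s1' : 0 < 1 - s by lra.
have xt : x < t by rewrite /t ltrDr mulr_gt0.
have t0 : 0 < t by lra.
have t1 : t < 1 by rewrite /t; nra.
have tE : 1 - t = (1 - x) * (1 - s) by rewrite /t; ring.
have t01 : 0 < t < 1 by rewrite t0.
have y01 : 0 <= 1 - t < 1 by lra.
rewrite (bpd_series _ _ _ aF)// -tE /c pseries_cauchy//; last 2 first.
  exact: radius_ge1_binc.
  exact: bpd_radius aF.
rewrite pseries_binc_pow// -/g.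
rewrite /bker s0 s1 mul1r.
have -> : (0 < x * t `^ (-1) < 1).
  by rewrite powR_inv1 ?ltW// divr_gt0//= ltr_pdivrMr// mul1r.
have -> : 1 - x * t `^ (-1) = (1 - x) * s * t `^ (-1).
  by rewrite powR_inv1 ?ltW//; rewrite /t in t0 *; field; rewrite gt_eqF.
rewrite mul1r tE !powRM ?powR_ge0 ?mulr_ge0 ?(ltW y0) ?(ltW s0) ?(ltW s1') ?(ltW x0)//.
have -> : (1 - x) `^ (g + d - 2) = (1 - x) `^ (g - 1) * (1 - x) `^ (d - 1).
  by rewrite -powRD ?(gt_eqF y0) ?implybT//; congr (_ `^ _); ring.
have -> : t `^ (- (z - 1)) = t `^ (-1) * ((t `^ (-1)) `^ (w - 1) * (t `^ (-1)) `^ (d - 1)).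
  by rewrite -!powRrM -!powRD ?(gt_eqF t0) ?implybT//; congr (_ `^ _); rewrite /d; ring.
move: (limn _) ((t `^ _) `^ (w - 1)) ((t `^ _) `^ (d - 1)) => A1 A2 A3.
move: (nconst ps) (x `^ _) (t `^ _) ((1 - x) `^ (g - 1)) => A4 A5 A6 A7.
ring.
Qed.

Let nconstE : nconst ((w, z) :: ps) = C * nconst ps * Beta d g.
Proof.
rewrite /nconst /sdelta !big_cons/= -/(sdelta ps) -/g -/d /C /Beta.
rewrite (_ : w + d = z) ?invfM ?invrK; last by rewrite /d; ring.
have /lt0r_neq0 := Gamma_gt0 _ d0; have /lt0r_neq0 := Gamma_gt0 _ (g0 : 0 < g).
have alg (A1 A2 A3 A4 A5 A6 : R) : A2 != 0 -> A1 != 0 ->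
    A4 * (A5 * A3 * A6) = A3 * A1^-1 * A5 * (A2^-1 * A6) * (A1 * A2 * A4).
  by move=> A20 A10; field; rewrite A10 A20.
exact: (alg (Gamma d) (Gamma g) (Gamma w)^-1 (Gamma (d + g))^-1 (Gamma z)).
Qed.

Let sdeltaE : sdelta ((w, z) :: ps) = g + d.
Proof. by rewrite /sdelta big_cons/= addrC. Qed.

(** The marginal density, extended-valued until its series shows that it is finite. *)
Let GE x : \bar R := (\int[mu]_t (h (x, t))%:E)%E.

Let GE_out x : ~~ (0 < x < 1) -> GE x = 0%E.
Proof. by move=> x01; rewrite /GE integral0_eq// => t _; rewrite h_out. Qed.

Let GE_series x : 0 < x < 1 -> GE x =
  (nconst ((w, z) :: ps) * (1 - x) `^ (sdelta ((w, z) :: ps) - 1) *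
   limn (pseries b (1 - x)))%:E.
Proof.
move=> x01; have /andP[x0 x1] := x01; have y0 : 0 < 1 - x by lra.
have y01 : 0 <= 1 - x < 1 by lra.
have mhx : measurable_fun [set: R] (fun t => (h (x, t))%:E).
  by apply/measurable_EFinP; exact: (@measurableT_comp _ _ _ _ _ _ h).
have h0x t : (0 <= (h (x, t))%:E)%E by rewrite lee_fin.
rewrite /GE (ge0_integral_affine (1 - x) x y0 _ mhx h0x).
have [int1 int2] := integral_bker_pseries d g (1 - x) c d0 g0 y01 c1.
under eq_integral do rewrite hE// EFinM.
rewrite integralZl// int2 -!EFinM; congr EFin.
rewrite /b pseries_cauchy//; last 2 first.
  exact: radius_ge1_binc.
  exact: radius_ge1_beta_ratio.
rewrite pseries_binc_pow// opprB nconstE sdeltaE.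
have -> : (1 - x) `^ (g + d - 1) = (1 - x) * (1 - x) `^ (g + d - 2).
  rewrite -[X in X * _]powRr1 ?ltW// -powRD ?(gt_eqF y0) ?implybT//.
  by congr (_ `^ _); ring.
have alg (A1 A2 A3 A4 A5 A6 A7 : R) :
  A1 * (A2 * A3 * A4 * A5 * (A6 * A7)) = A2 * A3 * A6 * (A1 * A5) * (A4 * A7) by ring.
exact: alg.
Qed.

Let G x := fine (GE x).

Let GK x : (G x)%:E = GE x.
Proof.
have [/GE_series|/GE_out] := boolP (0 < x < 1); rewrite /G => ->//.
Qed.

(** The substitution x = t s leaves t^n times the n-th moment of the beta variable. *)
Let moment_inner n t : (\int[mu]_x (x ^+ n * h (x, t))%:E =
  (t ^+ n * F t)%:E * (poch w n / poch z n)%:E)%E.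
Proof.
have [t01|t01] := boolP (0 < t < 1); last first.
  rewrite (bpd_out _ _ _ aF)// mulr0 mul0e integral0_eq// => x _.
  by rewrite /h/= (bpd_out _ _ _ aF)// mul0r mulr0.
have /andP[t0 t1] := t01.
have mx : measurable_fun [set: R] (fun x => (x ^+ n * h (x, t))%:E).
  apply/measurable_EFinP; apply: measurable_funM; first exact: exprn_measurable.
  exact: (@measurableT_comp _ _ _ _ _ _ h).
have hx0 x : (0 <= (x ^+ n * h (x, t))%:E)%E.
  rewrite lee_fin; have [/andP[x0 _]|x01] := boolP (0 < x < 1).
    by rewrite mulr_ge0// exprn_ge0// ltW.
  by rewrite h_out// mulr0.
rewrite (ge0_integral_affine t 0 t0 _ mx hx0).
have -> : (\int[mu]_x ((t * x + 0) ^+ n * h (t * x + 0, t))%:E =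
   \int[mu]_x ((t ^+ n * F t * t^-1 * C)%:E * (bker (w + n%:R) d x)%:E))%E.
  apply: eq_integral => x _; rewrite addr0 -EFinM /h/= powR_inv1 ?ltW//.
  rewrite -bker_mull exprMn (_ : t * x / t = x); last by field; rewrite gt_eqF.
  by congr EFin; ring.
rewrite ge0_integralZl//.
- have wn0 : 0 < w + n%:R by rewrite ltr_wpDr.
  rewrite -/(BetaE _ _) BetaEE// -!EFinM Beta_poch_l// (_ : w + d = z); last first.
    by rewrite /d; ring.
  rewrite /C; have /lt0r_neq0 := Beta_gt0 _ _ w0 d0.
  move: (Beta w d) (poch w n / poch z n) => B p B0.
  by congr EFin; field; rewrite B0 gt_eqF.
- by apply/measurable_EFinP; exact: measurable_bker.
- by move=> x _; rewrite lee_fin bker_ge0.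
- rewrite lee_fin !mulr_ge0 ?exprn_ge0 ?invr_ge0 ?(bpd_ge0 _ _ _ aF) ?(ltW t0)//.
  exact/ltW/Beta_gt0.
Qed.

Let moment n : (\int[mu]_x (x ^+ n * G x)%:E =
  (\prod_(p <- (w, z) :: ps) (poch p.1 n / poch p.2 n))%:E)%E.
Proof.
pose k (q : R * R) : \bar R := (q.1 ^+ n * h q)%:E.
have mk : measurable_fun setT k.
  apply/measurable_EFinP; apply: measurable_funM => //.
  apply: (@measurableT_comp _ _ _ _ _ _ (fun x : R => x ^+ n)).
    exact: exprn_measurable.
  exact: measurable_fst.
have k0 q : (0 <= k q)%E.
  rewrite lee_fin; case: q => x t; have [/andP[x0 _]|x01] := boolP (0 < x < 1).
    by rewrite mulr_ge0// exprn_ge0// ltW.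
  by rewrite h_out// mulr0.
transitivity (\int[mu]_x \int[mu]_t k (x, t))%E.
  apply: eq_integral => x _; rewrite EFinM GK /GE.
  have [/andP[x0 _]|x01] := boolP (0 < x < 1); last first.
    rewrite [RHS]integral0_eq => [|t _]; last by rewrite /k/= h_out// mulr0.
    by rewrite integral0_eq ?mule0// => t _; rewrite h_out.
  rewrite -ge0_integralZl//.
  - by apply/measurable_EFinP; exact: (@measurableT_comp _ _ _ _ _ _ h).
  - by move=> t _; rewrite lee_fin.
  - by rewrite lee_fin exprn_ge0// ltW.
etransitivity; first exact: (@fubini_tonelli _ _ _ _ R mu mu k mk k0).
under eq_integral do rewrite moment_inner.
have tF0 t : 0 <= t ^+ n * F t.
  have [/andP[t0 _]|t01] := boolP (0 < t < 1).
    by rewrite mulr_ge0 ?exprn_ge0 ?(bpd_ge0 _ _ _ aF)// ltW.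
  by rewrite (bpd_out _ _ _ aF)// mulr0.
rewrite ge0_integralZr//.
- by rewrite (bpd_moment _ _ _ aF) big_cons/= -EFinM mulrC.
- apply/measurable_EFinP; apply: measurable_funM; first exact: exprn_measurable.
  exact: bpd_measurable aF.
- by move=> t _; rewrite lee_fin.
- by rewrite lee_fin divr_ge0// ltW// poch_gt0// (lt_trans w0).
Qed.

Lemma beta_product_density_step : beta_product_density ((w, z) :: ps) b G.
Proof.
split.
- rewrite /b /c /cauchyM big_ord1/= /beta_ratio big_ord1 /binc !poch0 (bpd_coef0 _ _ _ aF).
  by rewrite fact0 !divr1 !mulr1.
- by apply: radius_ge1_cauchy; [exact: radius_ge1_binc|exact: radius_ge1_beta_ratio].
- apply: (@measurableT_comp _ _ _ _ _ _ (@fine R)); first exact: fine_measurable.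
  have mhE : measurable_fun setT (fun q => (h q)%:E) by exact/measurable_EFinP.
  have hE0 q : (0 <= (h q)%:E)%E by rewrite lee_fin.
  exact: (@measurable_fun_fubini_tonelli_F _ _ _ _ R mu _ mhE hE0).
- move=> x; rewrite -lee_fin GK; apply: integral_ge0 => t _.
  by rewrite lee_fin.
- by move=> x x01; rewrite /G GE_out.
- by move=> x x01; rewrite /G GE_series.
- exact: moment.
- rewrite sdeltaE /=; apply: hypergeom_eq_step => //.
  exact: bpd_eq aF.
Qed.

End step.

Lemma sdelta_gt0 ps : ps != [::] -> (forall p, p \in ps -> p.1 < p.2) -> 0 < sdelta ps.
Proof.
case: ps => // p ps _ pP; rewrite /sdelta big_cons ltr_wpDr//.
  rewrite big_seq sumr_ge0// => q qps; rewrite subr_ge0 ltW// pP//.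
  by rewrite inE qps orbT.
by rewrite subr_gt0 pP// mem_head.
Qed.

Lemma beta_product_density_exists ps : ps != [::] ->
  (forall p, p \in ps -> 0 < p.1 < p.2) -> exists a F, beta_product_density ps a F.
Proof.
elim: ps => // -[w z] [|p ps] IH _ pP.
  have /= /andP[w0 wz] := pP (w, z) (mem_head _ _).
  by do 2 eexists; exact: beta_density.
have /= /andP[w0 wz] := pP (w, z) (mem_head _ _).
have pP' q : q \in p :: ps -> 0 < q.1 < q.2 by move=> qps; apply: pP; rewrite inE qps orbT.
have [a [F aF]] := IH isT pP'.
have s0 : 0 < sdelta (p :: ps) by apply: sdelta_gt0 => // q /pP' /andP[].
by do 2 eexists; exact: beta_product_density_step w0 wz s0 aF.
Qed.

End density.

(** * Power series without their constant term *)

Section power_series_tail.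
Context {R : realType}.

Lemma pseries_tail (a : R^nat) (y : R) : cvgn (pseries a y) ->
  series (fun n => a n.+1 * y ^+ n.+1) @ \oo --> limn (pseries a y) - a 0%N.
Proof.
move=> ca; rewrite (_ : series _ = fun n => pseries a y n.+1 - a 0%N).
  apply: cvgB; last exact: cvg_cst.
  by rewrite (cvg_shiftS (pseries a y)).
apply/funext => n; rewrite /pseries /series/= [in RHS]big_nat_recl//=.
by rewrite expr0 mulr1 addrC addrA addNr add0r.
Qed.

End power_series_tail.

(** * The density on the closed interval *)

Theorem mainTheorem5 (R : realType) (m : nat) (u v : 'I_m -> R)
  (hm : (1 <= m)%N)
  (hu : forall i, 0 < u i) (huv : forall i, u i < v i) :
  exists f : R -> R,
    (* f is a density function on [0,1] *)
    (forall x : R, 0 <= x <= 1 -> 0 <= f x) /\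
    (@lebesgue_measure R).-integrable `[0%R, 1%R] (EFin \o f) /\
    (\int[@lebesgue_measure R]_(x in `[0%R, 1%R]) (f x)%:E = 1%:E)%E /\
    (* moment sequence *)
    (forall n : nat,
       (\int[@lebesgue_measure R]_(x in `[0%R, 1%R]) (x ^+ n * f x)%:E)%E
       = (\prod_(i < m) (poch (u i) n / poch (v i) n))%:E) /\
    (* series representation *)
    (forall x : R, 0 < x <= 1 ->
       cvgn (series (fun n => cc u v n.+1 * (1 - x) ^+ n.+1)) /\
       f x = (Gamma (delta u v))^-1 * (\prod_(i < m) (Gamma (v i) / Gamma (u i)))
             * (1 - x) `^ (delta u v - 1)
             * (1 + limn (series (fun n => cc u v n.+1 * (1 - x) ^+ n.+1)))).
Proof.
pose ps := [seq (u i, v i) | i <- enum 'I_m].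
have psP p : p \in ps -> 0 < p.1 < p.2.
  by move=> /mapP[i _ ->] /=; rewrite hu huv.
have ps0 : ps != [::] by rewrite -size_eq0 size_map size_enum_ord -lt0n.
have [a [F aF]] := beta_product_density_exists ps ps0 psP.
have sE : sdelta ps = delta u v by rewrite /sdelta big_map big_enum.
have g0 : 0 < delta u v by rewrite -sE; apply: sdelta_gt0 => // p /psP /andP[].
have acc : a = cc u v.
  apply/funext; apply: hypergeom_eq_cc => //; first exact: bpd_coef0 aF.
  have := bpd_eq _ _ _ aF; rewrite -!map_comp sE.
  exact.
have nE : nconst ps = (Gamma (delta u v))^-1 * (\prod_(i < m) (Gamma (v i) / Gamma (u i))).
  by rewrite /nconst sE big_map big_enum.
have n0 : 0 <= nconst ps.
  rewrite nE mulr_ge0//; first by rewrite invr_ge0 ltW// Gamma_gt0.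
  apply: prodr_ge0 => i _.
  by rewrite divr_ge0// ltW// Gamma_gt0// (lt_trans (hu i)).
(* The value demanded at x = 1, where 0 to the power delta - 1 is 1 if delta = 1 and 0 otherwise.
   Changing [F] at one point affects no integral. *)
pose k := nconst ps * 0 `^ (delta u v - 1).
pose f x := F x + k * \1_([set 1] : set R) x.
have fF x : x != 1 -> f x = F x.
  by move=> x1; rewrite /f indicE memNset ?mulr0 ?addr0//; exact/eqP.
have f1 : f 1 = k.
  by rewrite /f indicE mem_set// mulr1 (bpd_out _ _ _ aF) ?add0r// ltxx andbF.
have f0 x : 0 <= f x.
  by rewrite addr_ge0 ?(bpd_ge0 _ _ _ aF)// mulr_ge0// mulr_ge0// powR_ge0.
have mf : measurable_fun [set: R] f.
  apply: measurable_funD; first exact: bpd_measurable aF.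
  by apply: measurable_funM.
have moment n : (\int[@lebesgue_measure R]_(x in `[0%R, 1%R]) (x ^+ n * f x)%:E)%E
       = (\prod_(i < m) (poch (u i) n / poch (v i) n))%:E.
  have -> : \prod_(i < m) (poch (u i) n / poch (v i) n) =
      \prod_(p <- ps) (poch p.1 n / poch p.2 n) by rewrite big_map big_enum.
  rewrite -(bpd_moment _ _ _ aF) integral_itv_bndoo; last first.
    apply/measurable_EFinP/measurable_funTS; apply: measurable_funM => //.
  rewrite integral_gt0lt1E; apply: eq_integral => x _.
  have [/andP[x0 x1]|x01] := boolP (0 < x < 1); last first.
    by rewrite mul0r (bpd_out _ _ _ aF)// mulr0.
  by rewrite mul1r fF// lt_eqF.
have int1 : (\int[@lebesgue_measure R]_(x in `[0%R, 1%R]) (f x)%:E = 1%:E)%E.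
  have := moment 0%N; under eq_integral do rewrite expr0 mul1r.
  by move=> ->; rewrite big1// => i _; rewrite !poch0 divr1.
exists f; split; first by [].
split.
  apply/integrableP; split; first exact/measurable_EFinP/measurable_funTS.
  under eq_integral do rewrite /= ger0_norm//.
  by rewrite int1 ltry.
do 2 split=> //.
move=> x /andP[x0 x1]; have y01 : 0 <= 1 - x < 1 by lra.
have ca := radius_ge1_cvg _ _ (bpd_radius _ _ _ aF) y01.
have := pseries_tail _ _ ca; rewrite acc => ct; split; first exact: cvgP ct.
rewrite (cvg_lim _ ct)// -acc (bpd_coef0 _ _ _ aF) subrKC -nE.
move: x1; rewrite le_eqVlt => /predU1P[->|x1]; last first.
  by rewrite fF ?lt_eqF// (bpd_series _ _ _ aF) ?x0// sE.
by rewrite f1 subrr limn_pseries0 (bpd_coef0 _ _ _ aF) mulr1.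
Qed.
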